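(* Let $\beta>0$. For each $n\ge 1$ let $(Z^{(n)}_k)_{1\le k\le n}$ be a random family of points in $\mathbb{C}$, with empirical measure $\mu_n=\frac1n\sum_{k=1}^n\delta_{Z^{(n)}_k}$, let $P_n(z)=\prod_{j=1}^n(z-Z^{(n)}_j)$, and let $(\gamma^{(n)}_k)_{1\le k\le n}$ be i.i.d. Gamma random variables of parameter $\beta/2$, independent of $(Z^{(n)}_k)_{1\le k\le n}$. For $n\ge2$ let $\tilde\nu_n$ be the empirical measure of the zeros, counted with multiplicity, of the polynomial $$V_n(z)=P_n(z)\sum_{k=1}^n\frac{Z^{(n)}_k+z}{Z^{(n)}_k-z}\gamma^{(n)}_k.$$ If $(\mu_n)_{n\ge1}$ converges almost surely to a deterministic measure $\mu$ on $\mathbb{C}$, then $(\tilde\nu_n)_{n\ge2}$ converges almost surely to $\mu$.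
   Context: All random variables are defined on one probability space. The Gamma distribution of parameter $\beta/2$ has density $\frac{1}{\Gamma(\beta/2)}t^{\beta/2-1}e^{-t}$ on $(0,\infty)$. $V_n$ (the circular variant of the randomized derivative of $P_n$) is understood as the polynomial $V_n(z)=-\sum_{k=1}^n\gamma^{(n)}_k(Z^{(n)}_k+z)\prod_{1\le\ell\le n,\ \ell\ne k}(z-Z^{(n)}_\ell)$, which almost surely has degree $n$. The empirical measure of the zeros of a polynomial of degree $d\ge1$ is $\frac1d$ times the sum of the Dirac masses at its zeros, counted with multiplicity. Almost sure convergence of random probability measures means that, almost surely, the sequence converges weakly (tested against bounded continuous functions on $\mathbb{C}$). *)

(* Defs.v *)
From HB Require Import structures.
From mathcomp Require Export all_boot all_order all_algebra.
From mathcomp Require Export complex.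
From mathcomp Require Export all_classical all_reals all_analysis.
Export numFieldNormedType.Exports.

Set Implicit Arguments.
Unset Strict Implicit.
Unset Printing Implicit Defensive.

Import Order.TTheory GRing.Theory Num.Theory.
Local Open Scope classical_set_scope.
Local Open Scope ring_scope.
Local Open Scope complex_scope.

(* R[i] has no topology in the library: it is given the one of its norm, and
   the sigma-algebra generated by the open sets. *)
HB.instance Definition _ (R : rcfType) := PseudoPointedMetric.copy R[i] R[i]^o.
HB.instance Definition _ (R : rcfType) := NormedModule.copy R[i] R[i]^o.

HB.instance Definition _ (R : rcfType) :=
  Measurable.copy R[i] (g_sigma_algebraType (@open R[i])).

Section gamma.
Context {R : realType}.
Implicit Type a : R.

Definition Gamma a : R :=
  fine (\int[lebesgue_measure]_(t in `]0, +oo[) (t `^ (a - 1) * expR (- t))%:E).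

Definition gamma_pdf a : R -> R :=
  (fun t => (Gamma a)^-1 * t `^ (a - 1) * expR (- t)) \_ `]0, +oo[.

Definition gamma_prob a (A : set R) : \bar R :=
  (\int[lebesgue_measure]_(t in A) (gamma_pdf a t)%:E)%E.

End gamma.

Section independence.
Context d (T : measurableType d) (R : realType) (P : probability T R).

(* Taking some of the A i to be setT gives the product rule for subfamilies. *)
Definition mutually_independent d' (U : measurableType d') (I : finType)
    (X : I -> {RV P >-> U}) :=
  forall A : I -> set U, (forall i, measurable (A i)) ->
  P (\bigcap_i (X i @^-1` A i)) = (\prod_i P (X i @^-1` A i))%E.

Definition generated_sigma_algebra d' (U : measurableType d') (I : Type)
    (X : I -> {RV P >-> U}) : set (set T) :=
  <<s \bigcup_i g_sigma_algebra_preimage (X i) >>.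

Definition independent_families d1 (U1 : measurableType d1)
    d2 (U2 : measurableType d2) (I J : Type)
    (X : I -> {RV P >-> U1}) (Y : J -> {RV P >-> U2}) :=
  forall A B, generated_sigma_algebra X A -> generated_sigma_algebra Y B ->
  P (A `&` B) = (P A * P B)%E.

End independence.

Section empirical_measures.
Context {R : realType}.

(* This is the zero measure if s is empty. *)
Definition empirical_measure (s : seq R[i]) : {measure set R[i] -> \bar R} :=
  mscale ((size s)%:R^-1)%:nng (msum (fun k => \d_(nth 0 s k)) (size s)).

(* For p != 0, this lists the zeros of p with multiplicity, so that its size
   is the degree of p; for p = 0 its value is irrelevant. *)
Definition zeros (p : {poly R[i]}) : seq R[i] :=
  sval (closed_field_poly_normal p).

Definition weakly_cvg (m : nat -> {measure set R[i] -> \bar R})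
    (mu : {measure set R[i] -> \bar R}) :=
  forall f : R[i] -> R, continuous f -> bounded_fun f ->
  (\int[m n]_z (f z)%:E @[n --> \oo] --> \int[mu]_z (f z)%:E)%E.

End empirical_measures.

Section circular_randomized_derivative.
Context {R : realType} (n : nat).
Implicit Types (Z : 'I_n -> R[i]) (g : 'I_n -> R).

(* P(z) \sum_k g_k (Z_k + z) / (Z_k - z), where P has zeros Z_k, with the
   denominators cancelled; see circular_derivativeE. *)
Definition circular_derivative Z g : {poly R[i]} :=
  - \sum_(k < n) (g k)%:C *:
      (((Z k)%:P + 'X) * \prod_(l < n | l != k) ('X - (Z l)%:P)).

Lemma circular_derivativeE Z g z : (forall k, Z k != z) ->
  (circular_derivative Z g).[z] =
  (\prod_(j < n) ('X - (Z j)%:P)).[z] *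
  \sum_(k < n) (Z k + z) / (Z k - z) * (g k)%:C.
Proof.
move=> Zz; rewrite /circular_derivative hornerN horner_sum -sumrN mulr_sumr.
apply: eq_bigr => k _; have Zkz : Z k - z != 0 by rewrite subr_eq0.
rewrite hornerZ hornerM hornerD hornerX hornerC.
rewrite [X in _ = X.[_] * _](bigD1 k)//= hornerM hornerXsubC.
move: (_.[z]) (Z k + z) ((g k)%:C) => q a c.
rewrite -[z - Z k]opprB !mulNr; congr (- _); move: (Z k - z) Zkz => b b0.
by rewrite mulrC -[a / b]mulrC -!mulrA [RHS]mulrCA mulVKf// mulrCA.
Qed.

End circular_randomized_derivative.

(* Main.v *)
Require Import Defs.
From mathcomp Require Import ring lra zify measurable_realfun.
From mathcomp Require Import separable cyclotomic.

Set Implicit Arguments.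
Unset Strict Implicit.
Unset Printing Implicit Defensive.

(** Let [P] be the polynomial with zeros [Z k] and let [V] be its circular
    derivative with weights [g k]. Off the zeros, [|V y| = |P y| * |S y|] where
    [S y] is the sum of the [g k * (Z k + y) / (Z k - y)]. If [ln |S y|] is
    small compared with [n] at sufficiently many points [y], then [V] and [P]
    have nearly the same logarithmic potential, hence nearly the same zeros.
    The potentials are sampled at the vertices of regular polygons.

    Jensen's formula becomes an algebraic identity: the product of the [w - z]
    over the [N]-th roots [z] of [a] is [w ^+ N - a]. When [|a| = r ^+ N], its
    modulus is comparable with [max r |w| ^+ N] unless [w ^+ N] is very close
    to [a]. Distinct [M]-th roots of unity being [2 / M] apart, among [3 n + 1]
    rotations of a regular [n]-gon one has its vertices far from the zeros of
    [V], from the [Z k] and from the [- Z k] (exists_far_root). For that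
    [n]-gon, with centre [c] and radius [r], the average of [ln |V|] over the
    vertices is [ln |lead_coef V|] plus the sum of the [ln max r |w - c|] over
    the zeros [w] of [V], up to [O(ln n)]; likewise for [P]. Subtracting the
    results for two radii removes both the leading coefficient and the size of
    [S], and compares the sums over the zeros of [V] and of [P] of a compactly
    supported tent, with error [O(ln n)] (tent_sum_circular_derivative).

    The size of [S] is measured against the largest weight. The upper bound is
    immediate. The lower bound, by a factor [delta], can only fail if, for some
    [k], the weight [g k] satisfies [|g k - X| < delta * g k], where [X] is a
    function of the other weights and of the [Z l], hence independent of [g k].
    The logarithm of a Gamma variable has a bounded density, so this has
    probability [O(delta)] (near_value_prob). The vertices in play form a
    deterministic set of [(3 n + 1) n] points, so with [delta = n ^- 5] a union
    bound and the Borel-Cantelli lemma give the lower bound almost surely for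
    all large [n] (no_cancellation_ae).

    Finally, tents determine weak convergence (weakly_cvg_empirical_measure):
    below a nonnegative continuous [f] lies a positive combination of tents
    that carries a fixed fraction of the integral of [f]; iterating on the
    remainder bounds the averages of [f] from below in the limit, and the same
    bound for [M - f] concludes, as all the measures have mass one. *)

Import Order.TTheory GRing.Theory Num.Theory ComplexField.Normc.
Local Open Scope classical_set_scope.
Local Open Scope ring_scope.
Local Open Scope complex_scope.

(** * Modulus of a complex number *)

Section modulus.
Context {R : realType}.
Implicit Types x y z w : R[i].

Lemma normc_norm x : (normc x)%:C = `|x|.
Proof. by case: x. Qed.

Lemma normc_ge0 x : 0 <= normc x.
Proof. by case: x => a b; exact: sqrtr_ge0. Qed.

Lemma normc_eq0 x : (normc x == 0) = (x == 0).
Proof. by apply/eqP/eqP => [/eq0_normc//|->]; exact: normc0. Qed.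

Lemma normc_gt0 x : (0 < normc x) = (x != 0).
Proof. by rewrite lt_def normc_ge0 andbT normc_eq0. Qed.

Lemma normcX x n : normc (x ^+ n) = normc x ^+ n.
Proof.
elim: n => [|n IH]; first by rewrite !expr0 normc1.
by rewrite !exprS normcM IH.
Qed.

Lemma normc_prod (I : Type) (s : seq I) (Q : pred I) (F : I -> R[i]) :
  normc (\prod_(i <- s | Q i) F i) = \prod_(i <- s | Q i) normc (F i).
Proof. exact: (big_morph (fun z : R[i] => normc z) (@normcM R) (@normc1 R)). Qed.

Lemma normcB x y : normc (x - y) = normc (y - x).
Proof. by rewrite -normcN opprB. Qed.

Lemma ler_normcB x y : normc x - normc y <= normc (x - y).
Proof. by rewrite lerBlDr (le_trans _ (le_normcD _ _))// subrK. Qed.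

Lemma ler_normc_sum (I : Type) (s : seq I) (Q : pred I) (F : I -> R[i]) :
  normc (\sum_(i <- s | Q i) F i) <= \sum_(i <- s | Q i) normc (F i).
Proof.
elim/big_rec2 : _ => [|i u v _ uv]; first by rewrite normc0.
by rewrite (le_trans (le_normcD _ _))// lerD2l.
Qed.

Lemma normc_real (a : R) : normc a%:C = `|a|.
Proof. by rewrite /normc/= expr0n/= addr0 sqrtr_sqr. Qed.

Lemma ler_Re_normc x : `|complex.Re x| <= normc x.
Proof. by rewrite -lecR normc_norm normc_ge_Re. Qed.

Lemma normc_unity_root (M : nat) w : (0 < M)%N -> w ^+ M = 1 -> normc w = 1.
Proof.
move=> M0 wM; have : normc w ^+ M = 1 by rewrite -normcX wM normc1.
by move/eqP; rewrite pexpr_eq1// ?normc_ge0// => /eqP.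
Qed.

Lemma Re_sum (I : Type) (s : seq I) (Q : pred I) (F : I -> R[i]) :
  complex.Re (\sum_(i <- s | Q i) F i) = \sum_(i <- s | Q i) complex.Re (F i).
Proof.
have ReD (x y : R[i]) : complex.Re (x + y) = complex.Re x + complex.Re y.
  by case: x; case: y.
exact: (big_morph (@complex.Re R) ReD).
Qed.

Lemma ler_Re_Im_normc z : normc z <= `|complex.Re z| + `|complex.Im z|.
Proof.
have h0 : 0 <= `|complex.Re z| + `|complex.Im z| by rewrite addr_ge0.
rewrite -(ler_pXn2r (n := 2))// ?nnegrE ?normc_ge0//.
have -> : normc z ^+ 2 = complex.Re z ^+ 2 + complex.Im z ^+ 2.
  by case: z h0 => a b /= _; rewrite sqr_sqrtr// addr_ge0 ?sqr_ge0.
rewrite sqrrD !real_normK ?num_real//.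
have : 0 <= `|complex.Re z| * `|complex.Im z| by rewrite mulr_ge0.
lra.
Qed.

Lemma ler_Im_normc z : `|complex.Im z| <= normc z.
Proof.
rewrite -[leLHS]ger0_norm// -sqrtr_sqr /normc.
case: z => a b /=; rewrite ler_sqrt ?addr_ge0 ?sqr_ge0//.
by rewrite real_normK ?num_real// lerDr sqr_ge0.
Qed.

End modulus.

(** * Roots of unity *)

Section unity_roots.
Context {R : realType}.
Local Notation C := R[i].

(** Subtracting the vanishing sum of the powers of [w] from [M] writes [M] as
    the sum of the [1 - w ^+ i], each of modulus at most [i * |1 - w|]. *)
Lemma unity_root_sep (M : nat) (w : C) : (0 < M)%N -> w ^+ M = 1 -> w != 1 ->
  2 <= M%:R * normc (1 - w).
Proof.
case: M => [//|M] _ wM w1.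
have nw : normc w = 1 by exact: (@normc_unity_root _ M.+1).
have sum0 : \sum_(i < M.+1) w ^+ i = 0.
  apply/eqP; have /eqP := subrX1 w M.+1.
  by rewrite wM subrr eq_sym mulf_eq0 subr_eq0 (negbTE w1).
have le_i (i : nat) : normc (1 - w ^+ i) <= i%:R * normc (1 - w).
  elim: i => [|i IH]; first by rewrite expr0 subrr normc0 mul0r.
  have -> : 1 - w ^+ i.+1 = (1 - w ^+ i) + w ^+ i * (1 - w).
    by rewrite exprSr; ring.
  rewrite (le_trans (le_normcD _ _))// normcM normcX nw expr1n mul1r.
  by rewrite -[i.+1]addn1 natrD mulrDl mul1r lerD2r.
have : M.+1%:R <= (\sum_(i < M.+1) i%:R) * normc (1 - w).
  rewrite mulr_suml -[leLHS]normr_nat -normc_real rmorph_nat.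
  rewrite -[X in normc X]subr0 -[X in normc (_ - X)]sum0.
  rewrite -[X in X%:R - _](card_ord M.+1) -sum1_card natr_sum -sumrB.
  rewrite (le_trans (ler_normc_sum _ _ _))// ler_sum//.
have -> : \sum_(i < M.+1) i%:R = (M.+1 * M)%:R / 2 :> R.
  have := bin2_sum M.+1; rewrite big_mkord => /(congr1 (fun k => k%:R : R)).
  rewrite natr_sum => ->; apply: (mulIf (x := 2)); first by rewrite pnatr_eq0.
  have <- : ('C(M.+1, 2) * 2 = M.+1 * M)%N.
    by rewrite muln2 bin2 /= -[RHS]odd_double_half oddM/= andNb.
  by rewrite mulfVK ?pnatr_eq0// natrM.
move=> h; have x0 : 0 < M.+1%:R :> R by rewrite ltr0n.
have : 1 <= M%:R * normc (1 - w) / 2.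
  by rewrite -(ler_pM2l x0) mulr1 (le_trans h)// natrM; lra.
have := normc_ge0 (1 - w).
by rewrite -[M.+1]addn1 natrD; lra.
Qed.

Lemma unity_roots_exist (M : nat) : (0 < M)%N ->
  exists rs : seq C, [/\ uniq rs, size rs = M & forall w, w \in rs -> w ^+ M = 1].
Proof.
move=> M0; pose p : {poly C} := 'X^M - 1.
have [rs Dp] := closed_field_poly_normal p.
rewrite (monicP _) ?monicXnsubC// scale1r in Dp.
exists rs; split.
- by rewrite -separable_prod_XsubC -Dp separable_Xn_sub_1// pnatr_eq0 -lt0n.
- by apply/eqP; rewrite -eqSS -(size_prod_XsubC rs id) -Dp size_XnsubC.
- move=> w; rewrite -root_prod_XsubC -Dp => /eqP.
  by rewrite /p hornerD hornerXn hornerN hornerC => /subr0_eq.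
Qed.

(** Each obstacle in [xs] rules out at most one candidate in [rs], so fewer
    obstacles than candidates leave a good candidate. *)
Lemma avoid_bad (T U : eqType) (bad : T -> U -> bool) (xs : seq U) (rs : seq T) :
  uniq rs -> (size xs < size rs)%N ->
  (forall s t x, s \in rs -> t \in rs -> bad s x -> bad t x -> s = t) ->
  exists2 t, t \in rs & forall x, x \in xs -> ~~ bad t x.
Proof.
elim: xs rs => [|x xs IH] rs urs.
  by case: rs urs => // t rs _ _ _; exists t => //; rewrite mem_head.
move=> sz bad1.
have sz_bad : (size [seq t <- rs | bad t x] <= 1)%N.
  case E : [seq t <- rs | bad t x] => [|s [|t l]]//.
  have : uniq [seq t <- rs | bad t x] by rewrite filter_uniq.
  have := mem_filter (bad^~ x) s rs; have := mem_filter (bad^~ x) t rs.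
  rewrite E !in_cons !eqxx ?orbT => /esym/andP[bt tr] /esym/andP[bs sr].
  by rewrite (bad1 s t x)//= mem_head.
have [] := IH [seq t <- rs | ~~ bad t x].
- by rewrite filter_uniq.
- have := count_predC (bad^~ x) rs; rewrite -!size_filter /predC /= => e.
  rewrite /= in sz; rewrite -ltnS (leq_trans (n := size rs))// -e.
  by rewrite -add1n leq_add2r.
- by move=> s t y; rewrite !mem_filter => /andP[_ sr] /andP[_ tr]; exact: bad1.
move=> t; rewrite mem_filter => /andP[ntx tr] h; exists t => // y.
by rewrite in_cons => /predU1P[->//|]; exact: h.
Qed.

End unity_roots.

(** * Regular polygons inscribed in a circle *)

Section nth_roots.
Context {R : realType}.
Local Notation C := R[i].
Implicit Types (p : {poly C}) (a x z : C).

Lemma zerosE p : p = lead_coef p *: \prod_(z <- zeros p) ('X - z%:P).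
Proof. exact: svalP (closed_field_poly_normal p). Qed.

Lemma size_zeros p : p != 0 -> size p = (size (zeros p)).+1.
Proof.
move=> p0; rewrite {1}(zerosE p) size_scale ?lead_coef_eq0//.
exact: size_prod_XsubC.
Qed.

Lemma horner_zeros p x : p.[x] = lead_coef p * \prod_(z <- zeros p) (x - z).
Proof.
rewrite {1}(zerosE p) hornerZ horner_prod; congr (_ * _).
by apply: eq_bigr => z _; rewrite hornerXsubC.
Qed.

Definition nth_roots (N : nat) a : seq C := zeros ('X^N - a%:P).

Lemma prod_nth_roots N a x : (0 < N)%N ->
  \prod_(z <- nth_roots N a) (x - z) = x ^+ N - a.
Proof.
move=> N0; have := horner_zeros ('X^N - a%:P) x.
rewrite (monicP _) ?monicXnsubC// mul1r => <-.
by rewrite hornerD hornerXn hornerN hornerC.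
Qed.

Lemma size_nth_roots N a : (0 < N)%N -> size (nth_roots N a) = N.
Proof.
move=> N0; apply/eqP; rewrite -eqSS -size_zeros; first by rewrite size_XnsubC.
by rewrite -size_poly_eq0 size_XnsubC.
Qed.

Lemma nth_rootsX N a z : (0 < N)%N -> z \in nth_roots N a -> z ^+ N = a.
Proof.
move=> N0 zr; apply/subr0_eq; rewrite -prod_nth_roots//.
by apply/eqP; rewrite prodf_seq_eq0; apply/hasP; exists z; rewrite ?subrr/=.
Qed.

End nth_roots.

Section circle_points.
Context {R : realType}.
Local Notation C := R[i].
Implicit Types (w v x z c : C) (r : R).

(** A point [v] cannot be close to two points of a regular [M]-gon. Closeness
    is relative to the larger of [r] and [|v|]; a [v] close to the circle has
    modulus at most [2 r], which turns it into closeness relative to [r]. *)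
Lemma close_unity_roots (M : nat) r v w w' : (0 < M)%N -> 0 < r ->
  w ^+ M = 1 -> w' ^+ M = 1 ->
  normc (r%:C * w - v) < (2 * M%:R)^-1 * Num.max r (normc v) ->
  normc (r%:C * w' - v) < (2 * M%:R)^-1 * Num.max r (normc v) -> w = w'.
Proof.
move=> M0 r0 wM w'M; set m := Num.max _ _ => h h'.
have M1 : 1 <= M%:R :> R by rewrite ler1n.
have nrw u : u ^+ M = 1 -> normc (r%:C * u) = r.
  by move=> uM; rewrite normcM normc_real (normc_unity_root M0 uM) mulr1 gtr0_norm.
set k := (2 * M%:R)^-1 in h h' *.
have k0 : 0 < k by rewrite invr_gt0 mulr_gt0// ltr0n.
have kM : k * M%:R = 1 / 2 by rewrite /k invfM mulfVK ?mul1r// pnatr_eq0 -lt0n.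
have k2 : k <= 1 / 2 by rewrite -kM ler_peMr// ltW.
have m2 : m <= 2 * r.
  move: h; rewrite /m; have [_ _|vr h] := leP (normc v) r; first lra.
  have := ler_normcB v (r%:C * w); rewrite normcB nrw// => h1.
  have : k * normc v <= 1 / 2 * normc v by rewrite ler_wpM2r ?normc_ge0.
  lra.
apply/eqP/negPn/negP => ww'.
have w0 : w != 0 by rewrite -normc_gt0 (normc_unity_root M0 wM).
have w1 : w' / w != 1.
  by rewrite -(divff w0) (inj_eq (mulIf _)) ?invr_eq0// eq_sym.
have wwM : (w' / w) ^+ M = 1 by rewrite exprMn exprVn wM w'M divr1.
have := @unity_root_sep R M (w' / w) M0 wwM w1.
have -> : normc (1 - w' / w) = normc (w - w').
  rewrite -[X in X - _](divff w0) -mulrBl normcM normcV.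
  by rewrite (normc_unity_root M0 wM) invr1 mulr1.
have : r * normc (w - w') < 4 * k * r.
  have -> : r * normc (w - w') = normc ((r%:C * w - v) - (r%:C * w' - v)).
    by rewrite -[in LHS](gtr0_norm r0) -normc_real -normcM; congr normc; ring.
  rewrite (le_lt_trans (le_normcD _ _))// normcN.
  have : k * m <= k * (2 * r) by rewrite ler_pM2l.
  lra.
rewrite mulrC ltr_pM2r// -(ltr_pM2l (x := M%:R)) ?ltr0n//.
rewrite mulrCA [M%:R * k]mulrC kM; lra.
Qed.

Lemma max_exp r x (N : nat) : 0 <= r ->
  Num.max (r ^+ N) (normc x ^+ N) = Num.max r (normc x) ^+ N.
Proof.
move=> r0; have [xr|rx] := leP (normc x) r.
  by rewrite max_l// lerXn2r// nnegrE normc_ge0.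
by rewrite max_r// lerXn2r ?nnegrE ?normc_ge0// ltW.
Qed.

(** The rotation of the [N]-gon that avoids all the points [x]: its vertices
    are the [N]-th roots of [r ^+ N * w], and distance to the polygon is
    measured by [x ^+ N - r ^+ N * w]. *)
Lemma exists_far_root (M N : nat) r (xs : seq C) : 0 < r -> (size xs < M)%N ->
  exists2 w : C, w ^+ M = 1 & forall x, x \in xs ->
    (2 * M%:R)^-1 * Num.max r (normc x) ^+ N <= normc (x ^+ N - (r ^+ N)%:C * w).
Proof.
move=> r0 xsM; have M0 : (0 < M)%N by rewrite (leq_ltn_trans _ xsM).
have [rs [urs srs rsM]] := @unity_roots_exist R M M0.
pose bad w x := normc ((r ^+ N)%:C * w - x ^+ N) <
  (2 * M%:R)^-1 * Num.max (r ^+ N) (normc (x ^+ N)).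
have [||w wrs good] := @avoid_bad _ _ bad xs rs urs; first by rewrite srs.
  move=> w w' x wrs w'rs; apply: close_unity_roots => //; [|exact: rsM..].
  by rewrite exprn_gt0.
exists w => [|x /good]; first exact: rsM.
by rewrite /bad -leNgt normcX (max_exp _ _ (ltW r0)) normcB.
Qed.

Lemma ler_normc_circle (N : nat) r w x : 0 <= r -> normc w = 1 ->
  normc (x ^+ N - (r ^+ N)%:C * w) <= 2 * Num.max r (normc x) ^+ N.
Proof.
move=> r0 w1; rewrite -max_exp// (le_trans (le_normcD _ _))// normcN normcM w1.
rewrite normc_real mulr1 normcX ger0_norm ?exprn_ge0//.
have : normc x ^+ N <= Num.max (r ^+ N) (normc x ^+ N) by rewrite le_max lexx orbT.
have : r ^+ N <= Num.max (r ^+ N) (normc x ^+ N) by rewrite le_max lexx.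
lra.
Qed.

Lemma normc_nth_root (N : nat) r w z : (0 < N)%N -> 0 <= r -> normc w = 1 ->
  z \in nth_roots N ((r ^+ N)%:C * w) -> normc z = r.
Proof.
move=> N0 r0 w1 /(nth_rootsX N0)/(congr1 (fun u => normc u)).
rewrite normcX normcM w1 mulr1 normc_real ger0_norm ?exprn_ge0// => /eqP.
by rewrite eqrXn2 ?normc_ge0// => /eqP.
Qed.

(** Factoring [x ^+ N - z ^+ N] by [x - z] turns farness of the [N]-th powers
    into a distance to each single vertex. *)
Lemma far_nth_root (N : nat) (k r : R) w x z : (0 < N)%N -> 0 < r -> normc w = 1 ->
  z \in nth_roots N ((r ^+ N)%:C * w) ->
  k * Num.max r (normc x) ^+ N <= normc (x ^+ N - (r ^+ N)%:C * w) ->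
  k * r <= N%:R * normc (x - z).
Proof.
move=> N0 r0 w1 zr; have zN := nth_rootsX N0 zr.
have nz := normc_nth_root N0 (ltW r0) w1 zr.
set m := Num.max _ _; have mr : r <= m by rewrite le_max lexx.
have mx : normc x <= m by rewrite le_max lexx orbT.
have m0 : 0 < m by rewrite (lt_le_trans r0).
rewrite -zN subrXX normcM.
have hsum : normc (\sum_(i < N) x ^+ (N.-1 - i) * z ^+ i) <= N%:R * m ^+ N.-1.
  rewrite (le_trans (ler_normc_sum _ _ _))//.
  rewrite -[X in X%:R](card_ord N) -sum1_card natr_sum mulr_suml ler_sum// => i _.
  rewrite mul1r normcM !normcX nz.
  have -> : m ^+ N.-1 = m ^+ (N.-1 - i) * m ^+ i.
    by rewrite -exprD subnK// -ltnS prednK.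
  have [r0' m0'] := (ltW r0, ltW m0).
  by apply: ler_pM; rewrite ?exprn_ge0 ?normc_ge0// lerXn2r ?nnegrE ?normc_ge0.
rewrite -{1}(prednK N0) exprS => h.
have {}h : k * m * m ^+ N.-1 <= N%:R * normc (x - z) * m ^+ N.-1.
  rewrite -mulrA (le_trans h)// [N%:R * _]mulrC -mulrA ler_wpM2l ?normc_ge0//.
rewrite ler_pM2r ?exprn_gt0// in h.
have [k0|k0] := leP 0 k; first by rewrite (le_trans _ h)// ler_wpM2l.
by rewrite (@le_trans _ _ 0)// ?mulr_ge0 ?normc_ge0// nmulr_rle0// ltW.
Qed.

End circle_points.

(** * Discrete Jensen formula *)

Section circle_averages.
Context {R : realType}.
Local Notation C := R[i].
Implicit Types (w z c : C) (r : R) (ws zs : seq C).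

Lemma sum_size (I : Type) (s : seq I) (x : R) :
  (size s)%:R * x = \sum_(i <- s) x.
Proof. by rewrite big_const_seq count_predT iter_addr_0 mulr_natl. Qed.

Lemma ln_prod (I : eqType) (s : seq I) (F : I -> R) :
  (forall i, i \in s -> 0 < F i) ->
  ln (\prod_(i <- s) F i) = \sum_(i <- s) ln (F i).
Proof.
elim: s => [|i s IH] F0; first by rewrite !big_nil ln1.
have F0s j : j \in s -> 0 < F j by move=> js; rewrite F0// in_cons js orbT.
rewrite !big_cons lnM ?posrE ?IH//; first by rewrite F0// mem_head.
by rewrite big_seq; apply: prodr_gt0.
Qed.

Lemma ler_dist_ln (b s t : R) : 0 < b -> 0 < s ->
  b^-1 * s <= t <= b * s -> `|ln t - ln s| <= ln b.
Proof.
move=> b0 s0 /andP[l u]; have t0 : 0 < t.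
  by rewrite (lt_le_trans _ l)// mulr_gt0// invr_gt0.
have lt : ln (b^-1 * s) <= ln t by rewrite ler_ln ?posrE// mulr_gt0// invr_gt0.
have ut : ln t <= ln (b * s) by rewrite ler_ln ?posrE// mulr_gt0.
rewrite lnM ?posrE ?invr_gt0// lnV ?posrE// in lt.
rewrite lnM ?posrE// in ut.
by rewrite ler_norml; apply/andP; split; lra.
Qed.

(** The logarithmic potential at [w] of the uniform probability measure on the
    circle with centre [c] and radius [r]. *)
Definition logmax r c w : R := ln (Num.max r (normc (w - c))).

(** Exchanging the two sums, each [w] contributes
    [ln |(w - c) ^+ N - r ^+ N * u|], and farness pins this modulus between
    two multiples of [max r |w - c| ^+ N]. *)
Lemma circle_sum_ln (N M : nat) r u c ws : (0 < N)%N -> (0 < M)%N -> 0 < r ->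
  normc u = 1 ->
  (forall w, w \in ws -> (2 * M%:R)^-1 * Num.max r (normc (w - c)) ^+ N <=
     normc ((w - c) ^+ N - (r ^+ N)%:C * u)) ->
  `|\sum_(z <- nth_roots N ((r ^+ N)%:C * u))
      ln (normc (\prod_(w <- ws) (c + z - w)))
    - N%:R * \sum_(w <- ws) logmax r c w| <= (size ws)%:R * ln (2 * M%:R).
Proof.
move=> N0 M0 r0 u1 far; set a := (r ^+ N)%:C * u.
have m0 w : 0 < Num.max r (normc (w - c)) ^+ N.
  by rewrite exprn_gt0// lt_max r0.
have M1 : 1 <= M%:R :> R by rewrite ler1n.
have k0 : 0 < (2 * M%:R)^-1 :> R by rewrite invr_gt0 mulr_gt0// ltr0n.
have far0 w : w \in ws -> 0 < normc ((w - c) ^+ N - a).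
  by move=> /far; apply: lt_le_trans; rewrite mulr_gt0.
have ne z w : z \in nth_roots N a -> w \in ws -> 0 < normc (w - c - z).
  move=> zr /far0; rewrite !normc_gt0; apply: contra => /eqP/subr0_eq ->.
  by rewrite (nth_rootsX N0 zr) subrr.
have -> : \sum_(z <- nth_roots N a) ln (normc (\prod_(w <- ws) (c + z - w))) =
    \sum_(w <- ws) ln (normc ((w - c) ^+ N - a)).
  transitivity (\sum_(z <- nth_roots N a) \sum_(w <- ws) ln (normc (w - c - z))).
    apply: eq_big_seq => z zr; rewrite normc_prod.
    under eq_bigr do rewrite normcB opprD addrA.
    by rewrite ln_prod// => w ws_w; exact: ne.
  rewrite exchange_big/=; apply: eq_big_seq => w ws_w.
  by rewrite -prod_nth_roots// normc_prod ln_prod// => z zr; exact: ne.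
rewrite mulr_sumr -sumrB (le_trans (ler_norm_sum _ _ _))//.
rewrite sum_size !big_seq; apply: ler_sum => w ws_w.
have M2 : 0 < 2 * M%:R :> R by rewrite mulr_gt0// ltr0n.
rewrite /logmax mulr_natl -lnXn ?lt_max ?r0//.
apply: ler_dist_ln => //; rewrite far//=.
apply: le_trans (ler_normc_circle _ _ (ltW r0) u1) _.
by apply: ler_wpM2r; [exact: ltW|lra].
Qed.

(** Sum the logarithms of the hypothesis over the vertices and evaluate both
    sides by Jensen's formula. The constant [ln G - ln |lead_coef V|] is the
    same for every circle, so that it cancels between two radii. *)
Lemma logmax_sum_diff (N M : nat) r u c zs (V : {poly C}) (G b : R) :
  (0 < N)%N -> (0 < M)%N -> 0 < r -> normc u = 1 -> 0 < G -> 0 < b ->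
  V != 0 ->
  (forall w, w \in zs ++ zeros V -> (2 * M%:R)^-1 * Num.max r (normc (w - c)) ^+ N <=
     normc ((w - c) ^+ N - (r ^+ N)%:C * u)) ->
  (forall z, z \in nth_roots N ((r ^+ N)%:C * u) ->
     let p := normc (\prod_(x <- zs) (c + z - x)) in
     b^-1 * (G * p) <= normc V.[c + z] <= b * (G * p)) ->
  `|\sum_(w <- zeros V) logmax r c w - \sum_(w <- zs) logmax r c w
    - (ln G - ln (normc (lead_coef V)))| <=
  ln b + (size zs + size (zeros V))%:R / N%:R * ln (2 * M%:R).
Proof.
move=> N0 M0 r0 u1 G0 b0 V0 far VP; set a := (r ^+ N)%:C * u in far VP *.
have l0 : 0 < normc (lead_coef V) by rewrite normc_gt0 lead_coef_eq0.
have h1 : `|\sum_(z <- nth_roots N a)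
      ln (normc (\prod_(w <- zs) (c + z - w)))
    - N%:R * \sum_(w <- zs) logmax r c w| <= (size zs)%:R * ln (2 * M%:R).
  by apply: circle_sum_ln => // w wz; apply: far; rewrite mem_cat wz.
have h2 : `|\sum_(z <- nth_roots N a)
      ln (normc (\prod_(w <- zeros V) (c + z - w)))
    - N%:R * \sum_(w <- zeros V) logmax r c w| <=
      (size (zeros V))%:R * ln (2 * M%:R).
  by apply: circle_sum_ln => // w wz; apply: far; rewrite mem_cat wz orbT.
have ne z w : z \in nth_roots N a -> w \in zs ++ zeros V -> c + z - w != 0.
  move=> zr /far; rewrite -(nth_rootsX N0 zr); apply: contraTneq => e.
  have -> : w - c = z by apply/esym/subr0_eq; rewrite -e; ring.
  rewrite subrr normc0 leNgt mulr_gt0 ?invr_gt0 ?mulr_gt0 ?ltr0n//.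
  by rewrite exprn_gt0// lt_max r0.
have h3 : `|\sum_(z <- nth_roots N a) ln (normc V.[c + z])
    - \sum_(z <- nth_roots N a) ln (normc (\prod_(w <- zs) (c + z - w)))
    - N%:R * ln G| <= N%:R * ln b.
  rewrite -{3 4}(size_nth_roots a N0) !sum_size -!sumrB.
  rewrite (le_trans (ler_norm_sum _ _ _))// !big_seq.
  apply: ler_sum => z zr.
  have p0 : 0 < normc (\prod_(x <- zs) (c + z - x)).
    rewrite normc_prod big_seq prodr_gt0// => w wz.
    by rewrite normc_gt0 ne// mem_cat wz.
  rewrite -addrA -opprD -lnM ?posrE// [_ * G]mulrC.
  by apply: ler_dist_ln (VP z zr) => //; rewrite mulr_gt0.
have h4 : \sum_(z <- nth_roots N a) ln (normc V.[c + z]) =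
    N%:R * ln (normc (lead_coef V)) +
    \sum_(z <- nth_roots N a) ln (normc (\prod_(w <- zeros V) (c + z - w))).
  rewrite -{2}(size_nth_roots a N0) sum_size -big_split/=; apply: eq_big_seq => z zr.
  rewrite horner_zeros normcM lnM ?posrE// normc_prod big_seq prodr_gt0//.
  by move=> w wz; rewrite normc_gt0 ne// mem_cat wz orbT.
rewrite h4 in h3.
have Np : 0 < N%:R :> R by rewrite ltr0n.
rewrite -(ler_pM2l Np) mulrDr natrD.
have -> (x y : R) : N%:R * (x / N%:R * y) = x * y.
  by rewrite mulrA mulrCA divff ?mulr1// gt_eqF.
rewrite -[X in X * `|_|](gtr0_norm Np) -normrM.
move: h1 h2 h3.
set s1 := \sum_(z <- _) ln _; set s2 := \sum_(z <- _) ln _.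
set t1 := \sum_(w <- _) _; set t2 := \sum_(w <- zeros _) _.
rewrite !ler_norml => /andP[? ?] /andP[? ?] /andP[? ?]; apply/andP; split; nra.
Qed.

End circle_averages.

(** * The circular derivative at one point *)

Section one_polynomial.
Context {R : realType}.
Local Notation C := R[i].
Variables (n : nat) (Z : 'I_n -> C) (g : 'I_n -> R).
Hypothesis n_gt0 : (0 < n)%N.
Hypothesis g_gt0 : forall k, 0 < g k.
Implicit Types (c y : C) (r delta : R).

Let V := circular_derivative Z g.

(** For [x] on the unit circle, this is the Herglotz kernel. *)
Definition herglotz (x y : C) : C := (x + y) / (x - y).

Lemma sum_g_gt0 : 0 < \sum_k g k.
Proof.
by rewrite (bigD1 (Ordinal n_gt0))//= ltr_pwDl// sumr_ge0// => k _; exact: ltW.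
Qed.

Lemma size_circular_derivative : size V = n.+1.
Proof.
pose q k : {poly C} := ((Z k)%:P + 'X) * \prod_(l < n | l != k) ('X - (Z l)%:P).
have qm k : q k \is monic.
  by rewrite rpredM ?monic_prod_XsubC// addrC -[Z k]opprK polyCN monicXsubC.
have sq k : size (q k) = n.+1.
  rewrite /q size_Mmonic ?monic_prod_XsubC ?monic_neq0//; last first.
    by rewrite addrC -[Z k]opprK polyCN monicXsubC.
  rewrite -big_filter size_prod_XsubC addrC -[Z k]opprK polyCN size_XsubC/=.
  by rewrite size_filter -sum1_count sum1_card cardC1 card_ord prednK.
have Vn : V`_n = - (\sum_k g k)%:C.
  rewrite /V coefN coef_sum rmorph_sum/=; congr (- _); apply: eq_bigr => k _.
  have := qm k; rewrite monicE /lead_coef sq/= => /eqP e.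
  by rewrite coefZ e mulr1.
apply/eqP; rewrite eqn_leq; apply/andP; split.
  rewrite /V size_polyN (leq_trans (size_sum _ _ _))//.
  by apply/bigmax_leqP => k _; rewrite (leq_trans (size_scale_leq _ _))// sq.
rewrite ltnNge; apply/negP => /leq_sizeP/(_ n (leqnn n))/eqP.
by rewrite Vn oppr_eq0 eq_complex/= eqxx andbT gt_eqF// sum_g_gt0.
Qed.

Lemma circular_derivative_neq0 : V != 0.
Proof. by rewrite -size_poly_eq0 size_circular_derivative. Qed.

Lemma size_zeros_circular_derivative : size (zeros V) = n.
Proof.
by apply/eqP; rewrite -eqSS -size_zeros ?circular_derivative_neq0//
  size_circular_derivative.
Qed.

(** Dividing the sum of the [g l * herglotz (Z l) y] by its [k]-th kernel
    leaves [g k] plus terms independent of [g k]; the real part of the result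
    is required not to be much smaller than [g k]. *)
Definition no_cancellation delta y := forall k,
  delta * g k <= `|g k + \sum_(l < n | l != k)
    g l * complex.Re (herglotz (Z l) y / herglotz (Z k) y)|.

(** Only the distance from [x] to [y] matters, not the size of [x], because
    [x + y = (x - y) + 2 y]. *)
Lemma herglotz_bound h x y B : 0 < h -> h <= normc (x - y) -> normc y <= B ->
  normc (herglotz x y) <= 1 + 2 * B / h.
Proof.
move=> h0 hxy yB; have B0 : 0 <= B by rewrite (le_trans (normc_ge0 y)).
have d0 : 0 < normc (x - y) by exact: lt_le_trans hxy.
rewrite /herglotz normcM normcV ler_pdivrMr// mulrDl mul1r.
have : normc (x + y) <= normc (x - y) + 2 * normc y.
  have -> : x + y = (x - y) + (y + y) by ring.
  have := le_normcD y y; have := le_normcD (x - y) (y + y); lra.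
move=> /le_trans; apply; rewrite lerD2l.
rewrite -!mulrA ler_pM2l// (le_trans yB)//.
by rewrite ler_peMr// ler_pdivlMl// mulr1.
Qed.

Lemma herglotzV x y : (herglotz x y)^-1 = herglotz x (- y).
Proof. by rewrite /herglotz invf_div opprK. Qed.

Definition max_weight := \big[Num.max/0]_k g k.

Lemma max_weight_gt0 : 0 < max_weight.
Proof. exact: lt_le_trans (g_gt0 (Ordinal n_gt0)) (le_bigmax _ _ _). Qed.

(** The distance of [y] to the [Z k] and to the [- Z k] bounds every kernel and
    its inverse by [1 + 2 * B / h]. The lower bound comes from the absence of
    cancellation at the index [k] of the largest weight. *)
Lemma circular_derivative_bound delta h B y :
  0 < delta <= 1 -> 0 < h -> normc y <= B ->
  (forall k, h <= normc (Z k - y)) -> (forall k, h <= normc (Z k + y)) ->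
  no_cancellation delta y ->
  (n%:R * (1 + 2 * B / h) / delta)^-1 *
    (max_weight * normc (\prod_(x <- [seq Z k | k : 'I_n]) (y - x)))
  <= normc V.[y] <=
  n%:R * (1 + 2 * B / h) / delta *
    (max_weight * normc (\prod_(x <- [seq Z k | k : 'I_n]) (y - x))).
Proof.
move=> /andP[d0 d1] h0 yB hm hp nd; set A := 1 + 2 * B / h.
set b := _ / delta; set p := normc (\prod_(x <- _) _); set G := max_weight.
have B0 : 0 <= B by rewrite (le_trans (normc_ge0 y)).
have A1 : 1 <= A by rewrite lerDl divr_ge0 ?mulr_ge0// ltW.
have Zy k : Z k != y.
  apply/eqP => e; have := hm k.
  by rewrite e subrr normc0 leNgt h0.
have -> : normc V.[y] = normc (\sum_(k < n) herglotz (Z k) y * (g k)%:C) * p.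
  rewrite /V circular_derivativeE// normcM mulrC; congr (_ * _).
  rewrite /p big_image horner_prod; congr normc; apply: eq_bigr => k _.
  by rewrite hornerXsubC.
have p0 : 0 <= p by exact: normc_ge0.
set S := \sum_k _; rewrite !mulrA.
suff /andP[lo up] : b^-1 * G <= normc S <= b * G by rewrite !ler_wpM2r.
have n1 : 1 <= n%:R :> R by rewrite ler1n.
have gG k : g k <= G := le_bigmax _ _ _.
have G0 : 0 < G := max_weight_gt0.
have kA k : normc (herglotz (Z k) y) <= A by exact: herglotz_bound.
have kA' k : 1 <= A * normc (herglotz (Z k) y).
  have : normc (herglotz (Z k) y)^-1 <= A.
    by rewrite herglotzV herglotz_bound ?opprK ?normcN.
  have k0 : 0 < normc (herglotz (Z k) y).
    rewrite normc_gt0 mulf_neq0 ?invr_eq0 ?subr_eq0//.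
    by rewrite -normc_gt0 (lt_le_trans h0).
  by rewrite normcV -div1r ler_pdivrMr.
have ub : normc S <= n%:R * A * G.
  rewrite (le_trans (ler_normc_sum _ _ _))//.
  apply: (@le_trans _ _ (\sum_(k < n) A * G)).
    apply: ler_sum => k _; rewrite normcM normc_real gtr0_norm//.
    by rewrite ler_pM ?normc_ge0 ?kA ?gG// ltW.
  by rewrite sumr_const card_ord -[leLHS]mulr_natl mulrA.
apply/andP; split; last first.
  apply: (le_trans ub); rewrite ler_pM2r// /b ler_pdivlMr//.
  by rewrite ler_piMr// mulr_ge0// (le_trans _ A1).
have [K GK] : exists K, G = g K.
  have := @eq_bigmax _ _ _ 0 (Ordinal n_gt0) xpredT g erefl (fun k _ => ltW (g_gt0 k)).
  by move=> [K _ GK]; exists K.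
have K0 : herglotz (Z K) y != 0.
  by apply/eqP => e; have := kA' K; rewrite e normc0 mulr0 leNgt ltr01.
have : delta * G <= normc (S / herglotz (Z K) y).
  rewrite GK (le_trans (nd K))// (le_trans _ (ler_Re_normc _))//.
  rewrite /S mulr_suml Re_sum.
  have ReE l : complex.Re (herglotz (Z l) y * (g l)%:C / herglotz (Z K) y) =
      g l * complex.Re (herglotz (Z l) y / herglotz (Z K) y).
    rewrite [herglotz (Z l) y * _]mulrC -mulrA.
    by case: (herglotz (Z l) y / _) => a b' /=; rewrite mul0r subr0.
  rewrite [in leRHS](eq_bigr _ (fun l _ => ReE l)).
  by rewrite [in leRHS](bigD1 K)//= divff//= mulr1.
rewrite normcM normcV ler_pdivlMr ?normc_gt0// => lo.
rewrite (le_trans _ lo)// /b invf_div.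
have nA0 : 0 < n%:R * A.
  by rewrite mulr_gt0 ?(lt_le_trans _ n1) ?(lt_le_trans _ A1).
rewrite mulrAC ler_pdivrMr// -mulrA ler_peMr ?mulr_ge0 ?(ltW G0) ?(ltW d0)//.
rewrite mulrC -mulrA (le_trans (kA' K))// ler_peMl//.
by rewrite mulr_ge0 ?normc_ge0// (le_trans _ A1).
Qed.

End one_polynomial.

(** * Comparison of the zeros on logarithmic tents *)

Section zeros_comparison.
Context {R : realType}.
Local Notation C := R[i].
Implicit Types (c y : C) (r s : R).

(** The vertices of all the rotated [n]-gons among which a good one is chosen:
    a set that depends neither on the zeros nor on the weights. *)
Definition grid_points (n : nat) c r : seq C :=
  [seq c + z | u <- nth_roots (3 * n).+1 1, z <- nth_roots n ((r ^+ n)%:C * u)].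

Lemma size_grid_points n c r : (0 < n)%N ->
  size (grid_points n c r) = ((3 * n).+1 * n)%N.
Proof.
move=> n0; rewrite /grid_points size_allpairs_dep.
transitivity (size (@nth_roots R (3 * n).+1 1%R) * n)%N; last first.
  by rewrite size_nth_roots.
by elim: (nth_roots _ 1) => //= u us ->; rewrite size_nth_roots// mulSn.
Qed.

(** The [n]-gon must avoid the [n] points [Z k], the [n] zeros of the circular
    derivative and the [n] points [- Z k], hence the [3 n + 1] rotations. *)
Lemma logmax_sum_circular_derivative c r : 0 < r -> exists K : R,
  forall (n : nat) (Z : 'I_n -> C) (g : 'I_n -> R), (0 < n)%N ->
  (forall k, 0 < g k) ->
  (forall y, y \in grid_points n c r -> no_cancellation Z g (n%:R ^- 5) y) ->
  `|\sum_(w <- zeros (circular_derivative Z g)) logmax r c w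
    - \sum_(w <- [seq Z k | k : 'I_n]) logmax r c w
    - (ln (max_weight g) - ln (normc (lead_coef (circular_derivative Z g))))|
  <= K + 10 * ln n%:R.
Proof.
move=> r0; pose B := normc c + r.
exists (ln (1 + 16 * B / r) + 2 * ln 8) => n Z g n0 g0 nd.
set V := circular_derivative Z g.
set zs := [seq Z k | k : 'I_n]; pose M := (3 * n).+1.
have szs : size zs = n by rewrite size_image card_ord.
have sV : size (zeros V) = n by exact: size_zeros_circular_derivative.
pose ws := zs ++ zeros V.
pose xs := [seq w - c | w <- ws] ++ [seq - w - c | w <- zs].
have [|u uM far] := @exists_far_root R M n r xs r0.
  by rewrite size_cat (size_map _ ws) (size_map _ zs) size_cat szs sV /M; lia.
have M0 : (0 < M)%N by [].
have u1 := normc_unity_root M0 uM.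
have umem : u \in nth_roots M 1.
  have := prod_nth_roots 1 u M0; rewrite uM subrr => /eqP.
  by rewrite prodf_seq_eq0 => /hasP[z zM]/=; rewrite subr_eq0 => /eqP ->.
(* the distance that [far_nth_root] guarantees *)
pose h := (2 * M%:R)^-1 * r / n%:R.
have np : 0 < n%:R :> R by rewrite ltr0n.
have n1 : 1 <= n%:R :> R by rewrite ler1n.
have Mp : 0 < M%:R :> R by rewrite ltr0n.
have h0 : 0 < h by rewrite divr_gt0// mulr_gt0// invr_gt0 mulr_gt0.
have d0 : 0 < (n%:R ^- 5 : R) by rewrite invr_gt0 exprn_gt0.
have d1 : (n%:R ^- 5 : R) <= 1 by rewrite invf_le1 ?exprn_gt0// exprn_ege1.
pose b : R := n%:R * (1 + 2 * B / h) / n%:R ^- 5.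
have B0 : 0 < B by rewrite ltr_wpDl ?normc_ge0.
have A1 : 1 <= 1 + 2 * B / h by rewrite lerDl divr_ge0 ?mulr_ge0// ltW.
have A0 : 0 < 1 + 2 * B / h by rewrite (lt_le_trans _ A1).
have b0 : 0 < b by rewrite divr_gt0// mulr_gt0.
have hr : (2 * M%:R)^-1 * r = n%:R * h.
  by rewrite /h; field; rewrite !gt_eqF.
have := @logmax_sum_diff R n M r u c zs V (max_weight g) b n0 M0 r0 u1
  (max_weight_gt0 n0 g0) b0 (circular_derivative_neq0 _ n0 g0).
have -> : (size zs + size (zeros V))%:R / n%:R = 2 :> R.
  by rewrite szs sV addnn -mul2n natrM mulfK ?gt_eqF.
have xs_ws w : w \in ws -> w - c \in xs.
  by move=> wws; rewrite mem_cat; apply/orP; left; exact: (map_f (fun w => w - c)).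
have zsZ k : Z k \in zs by apply: map_f; rewrite mem_enum.
have xs_zs k : - Z k - c \in xs.
  rewrite mem_cat; apply/orP; right; exact: (map_f (fun w => - w - c)).
have zs_ws k : Z k \in ws by rewrite mem_cat zsZ.
move=> H; apply: le_trans (H _ _) _ => {H}.
- by move=> w wws; apply: far; exact: xs_ws.
- move=> z zr; apply: circular_derivative_bound => //.
  + by rewrite d0.
  + by rewrite (le_trans (le_normcD _ _))// (normc_nth_root n0 (ltW r0) u1 zr).
  + move=> k; have := far_nth_root n0 r0 u1 zr (far _ (xs_ws _ (zs_ws k))).
    by rewrite hr ler_pM2l// -addrA -opprD.
  + move=> k; have := far_nth_root n0 r0 u1 zr (far _ (xs_zs k)).
    by rewrite hr ler_pM2l// -normcN !opprB addrA [z + c]addrC opprK addrC.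
  + by apply: nd; apply/allpairsPdep; exists u, z; split.
have M4 : M%:R <= 4 * n%:R :> R by rewrite -natrM ler_nat /M; lia.
have K1 : 1 <= 1 + 16 * B / r by rewrite lerDl divr_ge0 ?mulr_ge0// ltW.
have b_le : b <= (1 + 16 * B / r) * n%:R ^+ 8.
  rewrite /b invrK.
  have -> : 2 * B / h = 4 * (B / r) * M%:R * n%:R.
    by rewrite /h; field; rewrite !gt_eqF.
  have Br : 0 <= B / r by apply: ltW; rewrite divr_gt0.
  have -> : (1 + 16 * B / r) * n%:R ^+ 8 =
      (n%:R * (n%:R ^+ 2 + 16 * (B / r) * n%:R ^+ 2)) * n%:R ^+ 5.
    by field; rewrite gt_eqF.
  rewrite ler_pM2r ?exprn_gt0// ler_pM2l//.
  apply: lerD; first by rewrite exprn_ege1.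
  have -> : 16 * (B / r) * n%:R ^+ 2 = 16 * (B / r) * n%:R * n%:R by ring.
  rewrite ler_pM2r//.
  have : B / r * M%:R <= B / r * (4 * n%:R) by rewrite ler_wpM2l.
  lra.
have lb : ln b <= ln (1 + 16 * B / r) + 8 * ln n%:R.
  have K0 : 0 < 1 + 16 * B / r by rewrite (lt_le_trans _ K1).
  rewrite (mulr_natl (ln n%:R) 8) -lnXn// -lnM ?posrE ?exprn_gt0//.
  by rewrite ler_ln ?posrE// mulr_gt0// exprn_gt0.
have lM : ln (2 * M%:R) <= ln 8 + ln n%:R :> R.
  by rewrite -lnM ?posrE// ler_ln ?posrE ?mulr_gt0//; lra.
lra.
Qed.

(** Constant on the disc of radius [r], zero outside the disc of radius [s],
    and a difference of two potentials of unit mass. *)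
Definition tent r s c w : R := logmax s c w - logmax r c w.

Lemma tent_sum_circular_derivative c r s : 0 < r -> 0 < s -> exists K : R,
  forall (n : nat) (Z : 'I_n -> C) (g : 'I_n -> R), (0 < n)%N ->
  (forall k, 0 < g k) ->
  (forall y, y \in grid_points n c r -> no_cancellation Z g (n%:R ^- 5) y) ->
  (forall y, y \in grid_points n c s -> no_cancellation Z g (n%:R ^- 5) y) ->
  `|\sum_(w <- zeros (circular_derivative Z g)) tent r s c w
    - \sum_(w <- [seq Z k | k : 'I_n]) tent r s c w| <= K + 20 * ln n%:R.
Proof.
move=> r0 s0; have [K HK] := logmax_sum_circular_derivative c r0.
have [L HL] := logmax_sum_circular_derivative c s0.
exists (K + L) => n Z g n0 g0 /(HK n Z g n0 g0) h1 /(HL n Z g n0 g0) h2.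
rewrite /tent !sumrB; move: h1 h2.
rewrite !ler_norml => /andP[? ?] /andP[? ?]; apply/andP; split; lra.
Qed.

End zeros_comparison.

(** * Tents as continuous functions on the complex plane *)

Section complex_plane_analysis.
Context {R : realType}.
Local Notation C := R[i].
Implicit Types (f : C -> R) (w z c : C).

Lemma complex_continuousP f : continuous f <->
  forall w e, 0 < e ->
    exists2 d, 0 < d & forall z, normc (w - z) < d -> `|f w - f z| < e.
Proof.
split=> [fc w e e0|fP w].
  have /cvgrPdist_lt/(_ e e0) := fc w; rewrite near_nbhs => /nbhs_ballP[d /= d0 H].
  exists (complex.Re d); first by move: d0; rewrite ltcE/= => /andP[_].
  move=> z wz; apply: H; rewrite /ball/= -normc_norm.
  by move: d0; rewrite !ltcE/= => /andP[/eqP -> _]; rewrite eqxx.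
apply/(@cvgrPdist_lt _ R^o _ _ (nbhs_filter w)) => e e0.
have [d d0 H] := fP w e e0.
rewrite near_nbhs; apply/nbhs_ballP; exists d%:C; first by rewrite /= ltcR.
by move=> z; rewrite /ball/= -normc_norm ltcR => /H.
Qed.

Lemma lipschitz_complex_continuous f (k : R) :
  (forall w z, `|f w - f z| <= k * normc (w - z)) -> continuous f.
Proof.
move=> fl; apply/complex_continuousP => w e e0.
have k1 : 0 < `|k| + 1 by rewrite ltr_wpDl.
exists (e / (`|k| + 1)) => [|z]; first by rewrite divr_gt0.
rewrite ltr_pdivlMr// => wz; rewrite (le_lt_trans (fl w z))//.
rewrite (le_lt_trans _ wz)// mulrC ler_wpM2l ?normc_ge0//.
by rewrite (le_trans (ler_norm k))// lerDl.
Qed.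

Lemma complex_continuous_measurable f : continuous f -> measurable_fun setT f.
Proof.
move=> /continuousP fc; apply: (measurability _ (RGenOInfty.measurableE R)).
move=> _ [_ [x ->] <-]; rewrite setTI; apply: sub_sigma_algebra.
by apply: fc; exact: interval_open.
Qed.

Lemma integral_empirical_measure (s : seq C) f : measurable_fun setT f ->
  (\int[empirical_measure s]_z (f z)%:E =
   ((size s)%:R^-1 * \sum_(w <- s) f w)%:E)%E.
Proof.
move=> mf.
have nonneg (h : C -> R) : measurable_fun setT h -> (forall z, 0 <= h z) ->
    (\int[empirical_measure s]_z (h z)%:E =
     ((size s)%:R^-1 * \sum_(w <- s) h w)%:E)%E.
  move=> mh h0; rewrite /empirical_measure ge0_integral_mscale//=; last 2 first.
    exact/measurable_EFinP.
    by move=> z _; rewrite lee_fin.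
  rewrite ge0_integral_measure_sum//; last 2 first.
    by move=> z _; rewrite lee_fin.
    exact/measurable_EFinP.
  rewrite (eq_bigr (fun k : 'I_(size s) => (h (nth 0 s k))%:E)); last first.
    move=> k _; rewrite integral_dirac//; last exact/measurable_EFinP.
    by rewrite diracT mul1e.
  by rewrite sumEFin [in RHS](big_nth 0) big_mkord EFinM.
rewrite integralE.
have -> : (fun z => (f z)%:E)^\+%E = (fun z => (f^\+ z)%:E).
  by apply/funext => z; rewrite funeposE -EFin_max.
have -> : (fun z => (f z)%:E)^\-%E = (fun z => (f^\- z)%:E).
  by apply/funext => z; rewrite funenegE -EFinN -EFin_max.
rewrite nonneg; [|exact: measurable_funrpos|exact: funrpos_ge0].
rewrite nonneg; [|exact: measurable_funrneg|exact: funrneg_ge0].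
rewrite -EFinB -mulrBr -sumrB; congr (_ * _)%:E; apply: eq_bigr => z _.
rewrite /funrpos /funrneg /=; have [fz|/ltW fz] := leP 0 (f z).
  by rewrite max_r ?oppr_le0// subr0.
by rewrite max_l ?oppr_ge0// sub0r opprK.
Qed.

Lemma normcB_lipschitz c w z : `|normc (w - c) - normc (z - c)| <= normc (w - z).
Proof.
rewrite ler_norml; have h1 := ler_normcB (w - c) (z - c).
have h2 := ler_normcB (z - c) (w - c).
have e1 : (w - c) - (z - c) = w - z by ring.
have e2 : (z - c) - (w - c) = z - w by ring.
rewrite e1 in h1; rewrite e2 (normcB z w) in h2; apply/andP; split; lra.
Qed.

(** The cut-off at [r] keeps the logarithm away from its singularity. *)
Lemma ln_max_lipschitz (r a b : R) : 0 < r ->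
  `|ln (Num.max r a) - ln (Num.max r b)| <= r^-1 * `|a - b|.
Proof.
move=> r0; wlog ab : a b / a <= b.
  by move=> H; have [/H//|/ltW/H] := leP a b; rewrite distrC [`|b - _|]distrC.
have mab : Num.max r a <= Num.max r b by rewrite ge_max le_max lexx le_max ab orbT.
have ma : 0 < Num.max r a by rewrite lt_max r0.
have mb : 0 < Num.max r b by rewrite lt_max r0.
rewrite distrC ger0_norm ?subr_ge0 ?ler_ln ?posrE//.
rewrite distrC ger0_norm ?subr_ge0//.
have rma : r <= Num.max r a by rewrite le_max lexx.
have ama : a <= Num.max r a by rewrite le_max lexx orbT.
have d0 : Num.max r b - Num.max r a <= b - a.
  by rewrite lerBlDr ge_max; apply/andP; split; lra.
rewrite -ln_div ?posrE//.
have -> : Num.max r b / Num.max r a = 1 + (Num.max r b - Num.max r a) / Num.max r a.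
  by field; rewrite gt_eqF.
have q0 : 0 <= (Num.max r b - Num.max r a) / Num.max r a.
  by rewrite divr_ge0 ?subr_ge0// ltW.
rewrite (le_trans (le_ln1Dx _))//; first lra.
rewrite ler_pdivrMr//.
have : r^-1 * (b - a) * r <= r^-1 * (b - a) * Num.max r a.
  by rewrite ler_wpM2l// mulr_ge0 ?subr_ge0// invr_ge0 ltW.
rewrite mulrAC mulVf ?gt_eqF// mul1r; lra.
Qed.

Lemma logmax_lipschitz (r : R) c w z : 0 < r ->
  `|logmax r c w - logmax r c z| <= r^-1 * normc (w - z).
Proof.
move=> r0; rewrite (le_trans (ln_max_lipschitz _ _ r0))//.
by rewrite ler_wpM2l ?invr_ge0 ?(ltW r0)// normcB_lipschitz.
Qed.

Lemma tent_continuous (r s : R) c : 0 < r -> 0 < s -> continuous (tent r s c).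
Proof.
move=> r0 s0; apply: (@lipschitz_complex_continuous _ (s^-1 + r^-1)) => w z.
have := logmax_lipschitz c w z r0; have := logmax_lipschitz c w z s0.
rewrite /tent mulrDl !ler_norml => /andP[? ?] /andP[? ?].
by apply/andP; split; lra.
Qed.

Lemma tent_in (r s : R) c w : 0 < r -> r <= s -> normc (w - c) <= r ->
  tent r s c w = ln (s / r).
Proof.
move=> r0 rs wr; rewrite /tent /logmax max_l ?(le_trans wr)//.
by rewrite max_l// ln_div// posrE (lt_le_trans r0).
Qed.

Lemma tent_out (r s : R) c w : r <= s -> s <= normc (w - c) ->
  tent r s c w = 0.
Proof.
move=> rs sw; rewrite /tent /logmax max_r// max_r ?subrr//.
exact: le_trans sw.
Qed.

Lemma tent_ge0 (r s : R) c w : 0 < r -> r <= s -> 0 <= tent r s c w.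
Proof.
move=> r0 rs; rewrite subr_ge0 /logmax ler_ln ?posrE ?lt_max ?r0 ?(lt_le_trans r0 rs)//.
by rewrite ge_max !le_max rs lexx orbT.
Qed.

Lemma tent_le (r s : R) c w : 0 < r -> r <= s -> tent r s c w <= ln (s / r).
Proof.
move=> r0 rs; have s0 := lt_le_trans r0 rs.
rewrite /tent /logmax; set x := normc _.
have m0 : 0 < Num.max r x by rewrite lt_max r0.
have M0 : 0 < Num.max s x by rewrite lt_max s0.
rewrite -ln_div ?posrE// ler_ln ?posrE ?divr_gt0//.
have sr : 1 <= s / r by rewrite ler_pdivlMr// mul1r.
rewrite ler_pdivrMr// maxr_pMr ?(le_trans ler01)// mulfVK ?gt_eqF//.
by rewrite ge_max !le_max lexx/= ler_peMl ?normc_ge0// orbT.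
Qed.

End complex_plane_analysis.

(** * Tents centred on a fine lattice *)

Section lattice_tents.
Context {R : realType}.
Local Notation C := R[i].
Implicit Types (f g : C -> R) (w z c : C).

Definition center (m i j : nat) : C :=
  (i%:R / m.+1%:R - m.+1%:R) +i* (j%:R / m.+1%:R - m.+1%:R).

(** The inner radius is twice the spacing, so that the inner discs cover; the
    outer radius is four times the spacing, so that overlaps stay bounded. *)
Definition lattice_tent m i j := tent (2 / m.+1%:R) (4 / m.+1%:R) (center m i j).

(** The integers within distance [4] of [x] are among the eight consecutive
    ones that start at the least of them. *)
Lemma lattice_overlap (N : nat) (x : R) :
  \sum_(i < N) (`|x - i%:R| < 4)%R%:R <= 8 :> R.
Proof.
rewrite -(big_mkord xpredT (fun i => (`|x - i%:R| < 4)%R%:R)) /index_iota subn0.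
set Q := fun i : nat => (`|x - i%:R| < 4)%R.
have -> : \sum_(i <- iota 0 N) (Q i)%:R = (size [seq i <- iota 0 N | Q i])%:R :> R.
  by rewrite -natr_sum size_filter -sum1_count [in RHS]big_mkcond;
    congr _%:R; apply: eq_bigr => i _; case: (Q i).
set l := [seq i <- _ | _]; have lQ i : i \in l -> Q i by rewrite mem_filter => /andP[].
have ul : uniq l by rewrite filter_uniq// iota_uniq.
rewrite ler_nat; case El : l => [//|a l']; rewrite -El.
have al : a \in l by rewrite El mem_head.
have exl : exists i, i \in l by exists a.
have [i0 i0l i0min] := ex_minnP exl.
rewrite -(size_iota i0 8); apply: uniq_leq_size => // i il.
rewrite mem_iota i0min//=.
have := lQ _ il; have := lQ _ i0l; rewrite /Q !ltr_norml => /andP[? ?] /andP[? ?].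
have : i%:R < i0%:R + 8 :> R by lra.
by rewrite -natrD ltr_nat.
Qed.

Lemma near_center m w : normc w < m.+1%:R ->
  exists i j : 'I_(2 * m.+1 ^ 2), normc (w - center m i j) <= 2 / m.+1%:R.
Proof.
move=> wm; have m0 : 0 < m.+1%:R :> R by rewrite ltr0n.
have coord (x : R) : `|x| < m.+1%:R -> exists i : 'I_(2 * m.+1 ^ 2),
    `|x - (i%:R / m.+1%:R - m.+1%:R)| <= m.+1%:R^-1.
  rewrite ltr_norml => /andP[x1 x2].
  (* the coordinate counted in lattice steps from the corner of the box *)
  pose y := (x + m.+1%:R) * m.+1%:R.
  have y0 : 0 <= y by rewrite mulr_ge0 ?ltW//; lra.
  have /andP[l u] := truncn_itv y0.
  have iN : (Num.truncn y < 2 * m.+1 ^ 2)%N.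
    rewrite -(ltr_nat R) (le_lt_trans l)// natrM natrX expr2 mulrA /y ltr_pM2r//; lra.
  exists (Ordinal iN) => /=.
  have -> : x - ((Num.truncn y)%:R / m.+1%:R - m.+1%:R) =
      (y - (Num.truncn y)%:R) / m.+1%:R.
    by rewrite /y; field; rewrite gt_eqF.
  rewrite ger0_norm; last by rewrite divr_ge0 ?subr_ge0// ltW.
  rewrite -[leRHS]mul1r ler_pM2r ?invr_gt0//.
  move: u; rewrite -[(Num.truncn y).+1]addn1 natrD => yt.
  by rewrite lerBlDl ltW.
have [i Hi] := coord _ (le_lt_trans (ler_Re_normc w) wm).
have [j Hj] := coord _ (le_lt_trans (ler_Im_normc w) wm).
exists i, j; rewrite (le_trans (ler_Re_Im_normc _))//.
have -> : 2 / m.+1%:R = m.+1%:R^-1 + m.+1%:R^-1 :> R by rewrite mulrDl mul1r.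
by case: w wm Hi Hj => a b /= _ Hi Hj; rewrite lerD.
Qed.

Lemma overlap_center m w (N : nat) :
  \sum_(i < N) \sum_(j < N) (normc (w - center m i j) < 4 / m.+1%:R)%R%:R <= 64 :> R.
Proof.
have m0 : 0 < m.+1%:R :> R by rewrite ltr0n.
pose x := (complex.Re w + m.+1%:R) * m.+1%:R.
pose y := (complex.Im w + m.+1%:R) * m.+1%:R.
apply: (@le_trans _ _ (\sum_(i < N) \sum_(j < N)
    (`|x - i%:R| < 4)%R%:R * (`|y - j%:R| < 4)%R%:R)).
  apply: ler_sum => i _; apply: ler_sum => j _; rewrite -natrM mulnb.
  case: ltP => [wc|_]; last by rewrite ler0n.
  have coord (t : R) (k : nat) : `|t - (k%:R / m.+1%:R - m.+1%:R)| < 4 / m.+1%:R ->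
      `|(t + m.+1%:R) * m.+1%:R - k%:R| < 4.
    have -> : (t + m.+1%:R) * m.+1%:R - k%:R =
        (t - (k%:R / m.+1%:R - m.+1%:R)) * m.+1%:R by field; rewrite gt_eqF.
    by rewrite normrM (gtr0_norm m0) ltr_pdivlMr.
  rewrite !coord//.
    apply: le_lt_trans wc; have := ler_Im_normc (w - center m i j).
    by case: (w).
  apply: le_lt_trans wc; have := ler_Re_normc (w - center m i j).
  by case: (w).
under eq_bigr do rewrite -mulr_sumr.
rewrite -mulr_suml.
rewrite (le_trans (ler_pM _ _ (lattice_overlap _ _) (lattice_overlap _ _)))//.
- by rewrite sumr_ge0.
- by rewrite sumr_ge0.
- by rewrite -natrM.
Qed.

End lattice_tents.

(** * Minorants built from tents *)

Section tent_criterion.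
Context {R : realType}.
Local Notation C := R[i].
Variable mu : {measure set C -> \bar R}.
Hypothesis mu1 : mu setT = 1%E.
Implicit Types (f g : C -> R) (w z c : C).

Definition bounded_continuous f :=
  continuous f /\ exists M, forall z, `|f z| <= M.

Local Notation J f := (Rintegral mu setT f).

Lemma bounded_continuous_integrable f :
  bounded_continuous f -> mu.-integrable setT (EFin \o f).
Proof.
move=> [fc [M fM]]; apply: measurable_bounded_integrable => //.
- by rewrite mu1 ltry.
- exact: complex_continuous_measurable.
- exists M; split; first exact: num_real.
  by move=> K MK z _; exact: le_trans (fM z) (ltW MK).
Qed.

Lemma integral_bounded_continuous f : bounded_continuous f ->
  (\int[mu]_z (f z)%:E)%E = (J f)%:E.
Proof.
move=> fb; rewrite /Rintegral fineK//.
by apply: integrable_fin_num => //; exact: bounded_continuous_integrable.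
Qed.

Lemma bounded_continuous_cst (a : R) : bounded_continuous (fun _ => a).
Proof.
split; last by exists `|a|.
by apply: (@lipschitz_complex_continuous _ _ 0) => w z; rewrite subrr normr0 mul0r.
Qed.

Lemma bounded_continuous_lin f g (a : R) :
  bounded_continuous f -> bounded_continuous g ->
  bounded_continuous (fun z => a * f z + g z).
Proof.
move=> [fc [M fM]] [gc [L gL]]; split; last first.
  exists (`|a| * M + L) => z; rewrite (le_trans (ler_normD _ _))// lerD//.
  by rewrite normrM ler_wpM2l.
apply/complex_continuousP => w e e0.
have a1 : 0 < `|a| + 1 by rewrite ltr_wpDl.
have e1 : 0 < e / 2 / (`|a| + 1) by rewrite !divr_gt0.
have e2 : 0 < e / 2 by rewrite divr_gt0.
have [d1 d10 H1] := (complex_continuousP f).1 fc w _ e1.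
have [d2 d20 H2] := (complex_continuousP g).1 gc w _ e2.
exists (Num.min d1 d2) => [|z]; first by rewrite lt_min d10.
rewrite lt_min => /andP[/H1 + /H2 h2]; rewrite ltr_pdivlMr// => h1.
have -> : a * f w + g w - (a * f z + g z) = a * (f w - f z) + (g w - g z) by ring.
rewrite (le_lt_trans (ler_normD _ _))// normrM.
have : 0 <= `|f w - f z| by [].
lra.
Qed.

Lemma Rintegral_lin f g (a : R) :
  bounded_continuous f -> bounded_continuous g ->
  J (fun z => a * f z + g z) = a * J f + J g.
Proof.
move=> /bounded_continuous_integrable fi /bounded_continuous_integrable gi.
rewrite RintegralD//; last exact: (integrableZl _ a fi).
by rewrite RintegralZl.
Qed.

Lemma Rintegral_probability_cst (a : R) : J (fun _ => a) = a.
Proof. by rewrite Rintegral_cst// mu1 mulr1. Qed.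

Lemma Rintegral_setT_ge0 f : (forall z, 0 <= f z) -> 0 <= J f.
Proof. by move=> f0; apply: Rintegral_ge0 => z _; exact: f0. Qed.

Lemma bounded_continuous_tent (r s : R) c : 0 < r -> r <= s ->
  bounded_continuous (tent r s c).
Proof.
move=> r0 rs; split; first by apply: tent_continuous => //; exact: lt_le_trans rs.
by exists (ln (s / r)) => z; rewrite ger0_norm ?tent_ge0// tent_le.
Qed.

Section minorant.
Variable f : C -> R.
Hypothesis fb : bounded_continuous f.
Hypothesis f0 : forall z, 0 <= f z.

(** The weight of a tent is the infimum of [f] over the open disc that supports
    it, so that the weighted tent, once normalised, lies below [f]. *)
Definition local_inf m i j : R :=
  inf (f @` [set z | normc (z - center m i j) < 4 / m.+1%:R]).

Definition tent_minorant m z : R :=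
  (64 * ln 2)^-1 * \sum_(i < 2 * m.+1 ^ 2) \sum_(j < 2 * m.+1 ^ 2)
    local_inf m i j * lattice_tent m i j z.

Let mpos m : 0 < m.+1%:R :> R. Proof. by rewrite ltr0n. Qed.

Lemma near_center_nonempty m i j :
  (f @` [set z | normc (z - center m i j) < 4 / m.+1%:R]) !=set0.
Proof.
have self : normc (center m i j - center m i j) < 4 / m.+1%:R :> R.
  by rewrite subrr normc0 divr_gt0.
by exists (f (center m i j)); exists (center m i j).
Qed.

Lemma local_inf_ge0 m i j : 0 <= local_inf m i j.
Proof.
by apply: lb_le_inf => [|_ [z _ <-]//]; exact: near_center_nonempty.
Qed.

Lemma local_inf_le m i j z : normc (z - center m i j) < 4 / m.+1%:R ->
  local_inf m i j <= f z.
Proof.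
move=> zc; apply: ge_inf; last by exists z.
by exists 0 => _ [y _ <-].
Qed.

Lemma lattice_tent_le m i j z : 0 <= lattice_tent m i j z <= ln 2.
Proof.
have r0 : 0 < 2 / m.+1%:R :> R by rewrite divr_gt0.
have rs : 2 / m.+1%:R <= 4 / m.+1%:R :> R by rewrite ler_pM2r ?invr_gt0//; lra.
rewrite tent_ge0//= (le_trans (tent_le _ _ r0 rs))//.
by rewrite (_ : 4 / _ / _ = 2)//; field; rewrite gt_eqF.
Qed.

Let ln2 : 0 < ln 2 :> R. Proof. by rewrite ln_gt0// ltr1n. Qed.
Let c0 : 0 < 64 * ln 2 :> R. Proof. by rewrite mulr_gt0. Qed.

Lemma tent_minorant_ge0 m z : 0 <= tent_minorant m z.
Proof.
rewrite mulr_ge0 ?invr_ge0 ?(ltW c0)// sumr_ge0// => i _.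
rewrite sumr_ge0// => j _; rewrite mulr_ge0 ?local_inf_ge0//.
by have /andP[] := lattice_tent_le m i j z.
Qed.

(** At most [64] tents are positive at [z], each with a weight at most [f z]. *)
Lemma tent_minorant_le m z : tent_minorant m z <= f z.
Proof.
rewrite /tent_minorant ler_pdivrMl//.
apply: (@le_trans _ _ (\sum_(i < 2 * m.+1 ^ 2) \sum_(j < 2 * m.+1 ^ 2)
   (normc (z - center m i j) < 4 / m.+1%:R)%R%:R * (f z * ln 2))).
  apply: ler_sum => i _; apply: ler_sum => j _.
  have /andP[t0 t1] := lattice_tent_le m i j z.
  have [zc|zc] := ltP.
    by rewrite mul1r ler_pM ?local_inf_ge0// local_inf_le.
  rewrite mul0r /lattice_tent tent_out ?mulr0//.
  by rewrite ler_pM2r ?invr_gt0//; lra.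
under eq_bigr do rewrite -mulr_suml.
rewrite -mulr_suml -mulrA [ln 2 * _]mulrC ler_wpM2r ?overlap_center//.
by rewrite mulr_ge0// ltW.
Qed.

(** By continuity, the weight of a tent whose inner disc contains [z] is close
    to [f z] when the lattice is fine. *)
Lemma tent_minorant_near z e : 0 < e ->
  \forall m \near \oo, f z - e <= 64 * tent_minorant m z.
Proof.
move=> e0; have [d d0 fd] := (complex_continuousP f).1 fb.1 z e e0.
near=> m.
have mz : normc z < m.+1%:R.
  near: m; exists (Num.truncn (normc z)).+1 => // m /= zm.
  have /andP[_ u] := truncn_itv (normc_ge0 z).
  by rewrite (lt_le_trans u)// ler_nat (leq_trans _ (leqnSn _)).
have md : 6 / m.+1%:R < d.
  near: m; exists (Num.truncn (6 / d)).+1 => // m /= zm.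
  have d6 : 0 <= 6 / d by rewrite divr_ge0// ltW.
  have /andP[_ u] := truncn_itv d6.
  rewrite ltr_pdivrMr// mulrC -ltr_pdivrMr// (lt_le_trans u)// ler_nat.
  by rewrite (leq_trans _ (leqnSn _)).
have [i [j zij]] := near_center mz.
have lower : f z - e <= local_inf m i j.
  apply: lb_le_inf; first exact: near_center_nonempty.
  move=> _ [y /= yc <-].
  have : normc (z - y) < d.
    apply: le_lt_trans md.
    have -> : z - y = (z - center m i j) - (y - center m i j) by ring.
    rewrite (le_trans (le_normcD _ _))// normcN.
    have -> : 6 / m.+1%:R = 2 / m.+1%:R + 4 / m.+1%:R :> R by field; rewrite gt_eqF.
    by rewrite lerD// ltW.
  by move=> /fd; rewrite ltr_norml => /andP[_ ?]; lra.
have zt : lattice_tent m i j z = ln 2.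
  rewrite /lattice_tent tent_in ?divr_gt0//; last first.
    by rewrite ler_pM2r ?invr_gt0//; lra.
  by congr ln; field; rewrite gt_eqF.
rewrite (le_trans lower)// /tent_minorant.
have -> : local_inf m i j =
    64 * ((64 * ln 2)^-1 * (local_inf m i j * lattice_tent m i j z)).
  by rewrite zt; field; rewrite gt_eqF.
rewrite ler_pM2l// ler_pM2l ?invr_gt0//.
have nn (k l : nat) : 0 <= local_inf m k l * lattice_tent m k l z.
  rewrite mulr_ge0 ?local_inf_ge0//.
  by have /andP[] := lattice_tent_le m k l z.
rewrite (bigD1 i)//= (bigD1 j)//= -addrA lerDl addr_ge0//.
  by rewrite sumr_ge0.
by rewrite sumr_ge0// => k _; rewrite sumr_ge0.
Unshelve. all: by end_near. Qed.

End minorant.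

End tent_criterion.

(** * Weak convergence from convergence on tents *)

Section weak_convergence.
Context {R : realType}.
Local Notation C := R[i].
Variable mu : {measure set C -> \bar R}.
Hypothesis mu1 : mu setT = 1%E.
Variable s : nat -> seq C.
Hypothesis s_neq0 : \forall n \near \oo, (0 < size (s n))%N.
Implicit Types (f g : C -> R).
Local Notation J f := (Rintegral mu setT f).

Definition mean n f : R := (size (s n))%:R^-1 * \sum_(w <- s n) f w.

Lemma mean_lin n f g a : mean n (fun z => a * f z + g z) = a * mean n f + mean n g.
Proof. by rewrite /mean big_split/= -mulr_sumr; ring. Qed.

Lemma mean_ge0 n f : (forall z, 0 <= f z) -> 0 <= mean n f.
Proof. by move=> f0; rewrite mulr_ge0 ?invr_ge0// sumr_ge0. Qed.

Lemma mean_cst n a : (0 < size (s n))%N -> mean n (fun _ => a) = a.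
Proof.
by move=> s0; rewrite /mean -sum_size mulrA mulVf ?mul1r// pnatr_eq0 -lt0n.
Qed.

Definition equidistributed f :=
  bounded_continuous f /\ mean ^~ f @ \oo --> J f.

Lemma equidistributed_lin f g a : equidistributed f -> equidistributed g ->
  equidistributed (fun z => a * f z + g z).
Proof.
move=> [fb fJ] [gb gJ]; split; first exact: bounded_continuous_lin.
rewrite (Rintegral_lin mu1)//.
under eq_fun do rewrite mean_lin.
by apply: cvgD => //; exact: cvgMr.
Qed.

Lemma equidistributed0 : equidistributed (fun _ => 0).
Proof.
split; first exact: bounded_continuous_cst.
rewrite (Rintegral_probability_cst mu1) (_ : mean ^~ _ = fun=> 0); first exact: cvg_cst.
by apply/funext => n; rewrite /mean big1 ?mulr0.
Qed.

Lemma equidistributed_sum (I : Type) (l : seq I) (a : I -> R) (F : I -> C -> R) :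
  (forall i, equidistributed (F i)) ->
  equidistributed (fun z => \sum_(i <- l) a i * F i z).
Proof.
move=> HF; elim: l => [|i l IH].
  by under eq_fun do rewrite big_nil; exact: equidistributed0.
by under eq_fun do rewrite big_cons; exact: equidistributed_lin.
Qed.

Hypothesis tents_equidistributed :
  forall m i j, mean ^~ (lattice_tent m i j) @ \oo --> J (lattice_tent m i j).

Lemma equidistributed_tent_minorant f m :
  equidistributed (tent_minorant f m).
Proof.
rewrite (_ : tent_minorant f m = fun z => (64 * ln 2)^-1 *
    (\sum_(p : 'I_(2 * m.+1 ^ 2) * 'I_(2 * m.+1 ^ 2))
      local_inf f m p.1 p.2 * lattice_tent m p.1 p.2 z) + 0); last first.
  by apply/funext => z; rewrite addr0 /tent_minorant pair_bigA.
apply: equidistributed_lin; last exact: equidistributed0.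
apply: equidistributed_sum => -[i j]; split; last exact: tents_equidistributed.
apply: bounded_continuous_tent; first by rewrite divr_gt0.
by rewrite ler_pM2r ?invr_gt0//; lra.
Qed.

(** Dominated convergence for the truncations [min (64 * tent_minorant) f],
    which tend to [f] pointwise as the lattice gets finer. The constant is twice
    the overlap bound [64]: some truncation has at least half the integral. *)
Lemma exists_minorant f : bounded_continuous f -> (forall z, 0 <= f z) ->
  0 < J f -> exists g, [/\ equidistributed g, forall z, 0 <= g z,
    forall z, g z <= f z & J f <= 128 * J g].
Proof.
move=> fb f0 Jf0.
pose g m z := Num.min (64 * tent_minorant f m z) (f z).
have mf : measurable_fun setT f by exact: complex_continuous_measurable fb.1.
have mt m : measurable_fun setT (tent_minorant f m).
  exact: complex_continuous_measurable (equidistributed_tent_minorant f m).1.1.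
have mg m : measurable_fun setT (g m).
  by apply: measurable_minr => //; exact: measurable_funM.
have g0 m z : 0 <= g m z.
  by rewrite le_min f0 andbT mulr_ge0// tent_minorant_ge0.
have gf m z : g m z <= f z by rewrite ge_min lexx orbT.
have [] := @dominated_convergence _ _ _ mu setT measurableT
  (fun m z => (g m z)%:E) (fun z => (f z)%:E) (fun z => (f z)%:E).
- by move=> m; exact/measurable_EFinP.
- exact/measurable_EFinP.
- apply/aeW => z _; apply/cvg_EFin; first by near=> m.
  apply/cvgrPdist_le => e e0.
  near=> m.
  have : f z - e <= 64 * tent_minorant f m z.
    by near: m; exact: tent_minorant_near.
  move=> h /=; rewrite ger0_norm ?subr_ge0 ?gf// lerBlDr -lerBlDl le_min.
  by rewrite h; lra.
- exact: (bounded_continuous_integrable mu1 fb).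
- by apply/aeW => z m _ /=; rewrite lee_fin ger0_norm.
move=> _ _; rewrite (integral_bounded_continuous mu1 fb) => /fine_cvgP[_ cvgJ].
have [m [mJ]] : exists m, J f / 2 < J (g m).
  have J2 : J f / 2 < J f by lra.
  have [m _ Hm] := cvgr_gt _ cvgJ _ J2.
  by exists m; exact: (Hm m (leqnn m)).
have [tb _] := equidistributed_tent_minorant f m.
have ti := bounded_continuous_integrable mu1 tb.
exists (tent_minorant f m); split.
- exact: equidistributed_tent_minorant.
- by move=> z; exact: tent_minorant_ge0.
- by move=> z; exact: tent_minorant_le.
- have : J (g m) <= 64 * J (tent_minorant f m).
    rewrite -RintegralZl//; apply: le_Rintegral => //.
    + apply: le_integrable (bounded_continuous_integrable mu1 fb) => //.
        by apply/measurable_EFinP; exact: mg.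
      by move=> z _ /=; rewrite lee_fin (ger0_norm (g0 m z)) (ger0_norm (f0 z)) gf.
    + exact: (integrableZl _ 64 ti).
    + by move=> z _; rewrite ge_min lexx.
  lra.
Unshelve. all: by end_near. Qed.

(** Induction on [k]: after removing a minorant on which convergence holds, the
    remainder has integral at most [127 / 128] times that of [f], and the
    trivial bound [0 <= mean] is used for it at the last step. *)
Lemma mean_lower_bound k f e : bounded_continuous f -> (forall z, 0 <= f z) ->
  0 < e ->
  \forall n \near \oo, J f - (127 / 128) ^+ k * J f - e <= mean n f.
Proof.
elim: k f e => [|k IH] f e fb f0 e0.
  near=> n; rewrite expr0 mul1r subrr sub0r.
  by rewrite (@le_trans _ _ 0) ?mean_ge0// oppr_le0 ltW.
have [Jf0|Jf0] := leP (J f) 0.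
  have -> : J f = 0 by apply/le_anti; rewrite Jf0 Rintegral_setT_ge0.
  near=> n; rewrite mulr0 subrr sub0r.
  by rewrite (@le_trans _ _ 0) ?mean_ge0// oppr_le0 ltW.
have [g [[gb gJ] g0 gf Jg]] := exists_minorant fb f0 Jf0.
have e20 : 0 < e / 2 by rewrite divr_gt0.
have fgE : (fun z => f z - g z) = (fun z => -1 * g z + f z).
  by apply/funext => z; rewrite mulN1r addrC.
have fgb : bounded_continuous (fun z => f z - g z).
  by rewrite fgE; exact: bounded_continuous_lin.
have JfgE : J (fun z => f z - g z) = J f - J g.
  by rewrite fgE (Rintegral_lin mu1)// mulN1r addrC.
have fg0 z : 0 <= f z - g z by rewrite subr_ge0.
near=> n.
have h1 : J f - J g - (127 / 128) ^+ k * (J f - J g) - e / 2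
    <= mean n (fun z => f z - g z).
  by rewrite -JfgE; near: n; exact: IH.
have h2 : J g - e / 2 <= mean n g.
  rewrite lerBlDr -lerBlDl.
  near: n; move/cvgrPdist_le : gJ => /(_ _ e20); apply: filterS => n.
  by rewrite ler_norml => /andP[].
have h3 : mean n f = mean n (fun z => f z - g z) + mean n g.
  by rewrite fgE mean_lin mulN1r; lra.
have h4 : (127 / 128) ^+ k * (J f - J g) <= (127 / 128) ^+ k * (127 / 128 * J f).
  by rewrite ler_wpM2l ?exprn_ge0//; lra.
rewrite exprSr -mulrA h3; lra.
Unshelve. all: by end_near. Qed.

(** The lower bound, applied to [M + f] and to [M - f]. *)
Lemma mean_cvg f : bounded_continuous f -> mean ^~ f @ \oo --> J f.
Proof.
have lower g : bounded_continuous g -> (forall z, 0 <= g z) ->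
    forall e, 0 < e -> \forall n \near \oo, J g - e <= mean n g.
  move=> gb g0 e e0.
  have q0 : 0 <= 127 / 128 :> R by lra.
  have q1 : 127 / 128 < 1 :> R by lra.
  have /cvgrPdist_lt/(_ (e / 2 / (J g + 1))) :
      (127 / 128) ^+ k @[k --> \oo] --> (0 : R).
    by apply: cvg_expr; rewrite ger0_norm.
  have Jg1 : 0 < J g + 1 by rewrite ltr_wpDl// Rintegral_setT_ge0.
  rewrite !divr_gt0// => /(_ erefl)[k _ /(_ k (leqnn k))].
  rewrite /= sub0r normrN ger0_norm ?exprn_ge0//.
  rewrite ltr_pdivlMr// => hk.
  have := mean_lower_bound k gb g0 (_ : 0 < e / 2).
  rewrite divr_gt0// => /(_ erefl); apply: filterS => n.
  have : 0 <= (127 / 128 : R) ^+ k by rewrite exprn_ge0.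
  lra.
move=> fb; have [fc [M fM]] := fb.
have cb a := bounded_continuous_cst a.
have lb : bounded_continuous (fun z => 1 * f z + M) by exact: bounded_continuous_lin.
have ub : bounded_continuous (fun z => -1 * f z + M) by exact: bounded_continuous_lin.
have lM z : 0 <= 1 * f z + M.
  by have := fM z; rewrite ler_norml => /andP[? ?]; lra.
have uM z : 0 <= -1 * f z + M.
  by have := fM z; rewrite ler_norml => /andP[? ?]; lra.
apply/cvgrPdist_le => e e0; near=> n.
have sn : (0 < size (s n))%N by near: n.
have h1 : J (fun z => 1 * f z + M) - e <= mean n (fun z => 1 * f z + M).
  by near: n; exact: lower.
have h2 : J (fun z => -1 * f z + M) - e <= mean n (fun z => -1 * f z + M).
  by near: n; exact: lower.
rewrite mean_lin (Rintegral_lin mu1)// mean_cst// (Rintegral_probability_cst mu1) in h1.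
rewrite mean_lin (Rintegral_lin mu1)// mean_cst// (Rintegral_probability_cst mu1) in h2.
by rewrite ler_norml; apply/andP; split; lra.
Unshelve. all: by end_near. Qed.

Lemma weakly_cvg_empirical_measure : weakly_cvg (fun n => empirical_measure (s n)) mu.
Proof.
move=> f fc [M [_ fM]].
have fb : bounded_continuous f.
  by split=> //; exists (M + 1) => z; apply: (fM (M + 1)); rewrite ?ltrDl.
rewrite (integral_bounded_continuous mu1 fb).
rewrite (_ : (fun n => _) = EFin \o mean ^~ f).
  by apply: cvg_EFin; [near=> n|exact: mean_cvg].
apply/funext => n; rewrite integral_empirical_measure//.
exact: complex_continuous_measurable.
Unshelve. all: by end_near. Qed.

End weak_convergence.

(** * Independence of one weight from the rest *)

Section complex_measurability.
Context d (T : measurableType d) {R : realType}.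
Local Notation C := R[i].
Implicit Types (F G : T -> C).

Definition measurable_complex F :=
  measurable_fun setT (fun t => complex.Re (F t)) /\
  measurable_fun setT (fun t => complex.Im (F t)).

Lemma measurable_fun_complex F : measurable_fun setT F -> measurable_complex F.
Proof.
move=> mF; split; apply: (measurableT_comp _ mF); apply: complex_continuous_measurable;
  apply: (@lipschitz_complex_continuous _ _ 1) => w z; rewrite mul1r.
  by apply: le_trans (ler_Re_normc (w - z)); case: w => ? ?; case: z.
by apply: le_trans (ler_Im_normc (w - z)); case: w => ? ?; case: z.
Qed.

Lemma measurable_complex_cst (c : C) : measurable_complex (fun _ => c).
Proof. by split; exact: measurable_cst. Qed.

Lemma measurable_complexD F G : measurable_complex F -> measurable_complex G ->
  measurable_complex (fun t => F t + G t).
Proof.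
move=> [F1 F2] [G1 G2]; split.
  rewrite (_ : (fun t => _) = fun t => complex.Re (F t) + complex.Re (G t)).
    exact: measurable_funD.
  by apply/funext => t; case: (F t) => ? ?; case: (G t).
rewrite (_ : (fun t => _) = fun t => complex.Im (F t) + complex.Im (G t)).
  exact: measurable_funD.
by apply/funext => t; case: (F t) => ? ?; case: (G t).
Qed.

Lemma measurable_complexM F G : measurable_complex F -> measurable_complex G ->
  measurable_complex (fun t => F t * G t).
Proof.
move=> [F1 F2] [G1 G2]; split.
  rewrite (_ : (fun t => _) = fun t => complex.Re (F t) * complex.Re (G t) -
      complex.Im (F t) * complex.Im (G t)).
    by apply: measurable_funB; exact: measurable_funM.
  by apply/funext => t; case: (F t) => ? ?; case: (G t).
rewrite (_ : (fun t => _) = fun t => complex.Re (F t) * complex.Im (G t) +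
      complex.Im (F t) * complex.Re (G t)).
  by apply: measurable_funD; exact: measurable_funM.
by apply/funext => t; case: (F t) => ? ?; case: (G t) => ? ? /=; rewrite addrC.
Qed.

Lemma measurable_complexV F : measurable_complex F ->
  measurable_complex (fun t => (F t)^-1).
Proof.
move=> [F1 F2].
(* the inverse of a nonnegative real is its power of exponent [-1] *)
pose q t := complex.Re (F t) ^+ 2 + complex.Im (F t) ^+ 2.
have q0 t : 0 <= q t by rewrite addr_ge0 ?sqr_ge0.
have mq : measurable_fun setT (fun t => q t `^ (-1)).
  apply: (measurableT_comp (measurable_powR (-1))).
  by apply: measurable_funD; exact: measurable_funX.
split.
  rewrite (_ : (fun t => _) = fun t => complex.Re (F t) * q t `^ (-1)).
    exact: measurable_funM.
  by apply/funext => t; rewrite powR_inv1// /q; case: (F t).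
rewrite (_ : (fun t => _) = fun t => - complex.Im (F t) * q t `^ (-1)).
  by apply: measurable_funM => //; exact: measurable_funN.
by apply/funext => t; rewrite powR_inv1// /q; case: (F t) => a b /=; rewrite mulNr.
Qed.

Lemma measurable_herglotz F y : measurable_fun setT F ->
  measurable_complex (fun t => herglotz (F t) y).
Proof.
move=> /measurable_fun_complex mF; apply: measurable_complexM.
  exact: measurable_complexD (measurable_complex_cst y).
apply: measurable_complexV.
exact: measurable_complexD (measurable_complex_cst (- y)).
Qed.

End complex_measurability.

Section independence.
Context d (T : measurableType d) {R : realType} (P : probability T R).
Local Open Scope ereal_scope.

(** Uniqueness of finite measures that agree on a pi-system, for the measures
    [P (A `&` _)] and [P A * P _]. *)
Lemma independent_generated (G : set (set T)) (A : set T) :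
  setI_closed G -> G setT -> G `<=` measurable -> measurable A ->
  (forall H, G H -> P (A `&` H) = P A * P H) ->
  forall H, <<s G >> H -> P (A `&` H) = P A * P H.
Proof.
move=> GI GT Gm mA indep.
have PAfin : (P A) \is a fin_num by exact: fin_num_measure.
have PA0 : (0 <= fine (P A))%R by rewrite fine_ge0.
pose m1 : {measure set T -> \bar R} := mrestr P mA.
pose m2 : {measure set T -> \bar R} := mscale (NngNum PA0) P.
have m2E H : m2 H = P A * P H by rewrite /m2/= /mscale/= fineK.
have m1E H : m1 H = P (A `&` H) by rewrite /m1/= /mrestr setIC.
move=> H GH; rewrite -m1E -m2E.
apply: (g_sigma_algebra_measure_unique G Gm (fun=> setT)) => //.
- by rewrite bigcup_const.
- by move=> B GB; rewrite m1E m2E indep.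
- by move=> _; rewrite m1E (le_lt_trans (probability_le1 P _)) ?ltry// setIT.
Qed.

Section others.
Variables (n : nat) (g : 'I_n -> {RV P >-> R}) (Z : 'I_n -> {RV P >-> R[i]}).
Hypothesis g_indep : mutually_independent g.
Hypothesis gZ_indep : independent_families g Z.
Variable k : 'I_n.

(** A pi-system that generates the sigma-algebra of the weights other than [g k]
    together with all the [Z l]. *)
Definition others : set (set T) := [set H | exists B C,
  [/\ forall l, measurable (B l), B k = setT, generated_sigma_algebra Z C &
      H = \bigcap_l (g l @^-1` B l) `&` C]].

Lemma bigcap_generated (B : 'I_n -> set R) : (forall l, measurable (B l)) ->
  generated_sigma_algebra g (\bigcap_l (g l @^-1` B l)).
Proof.
move=> mB; apply: (@fin_bigcap_measurable _ (g_sigma_algebraType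
  (\bigcup_i g_sigma_algebra_preimage (g i)))) => // l _.
apply: sub_sigma_algebra; exists l => //.
by exists (B l) => //; rewrite setTI.
Qed.

Lemma generated_measurable d' (U : measurableType d') (X : 'I_n -> {RV P >-> U}) C :
  generated_sigma_algebra X C -> measurable C.
Proof.
apply: smallest_sub; first exact: sigma_algebra_measurable.
by move=> _ [i _ [B mB <-]]; exact: measurable_funP.
Qed.

Lemma others_setI : setI_closed others.
Proof.
move=> _ _ [B [C [mB Bk ZC ->]]] [B' [C' [mB' Bk' ZC' ->]]].
exists (fun l => B l `&` B' l), (C `&` C'); split.
- by move=> l; exact: measurableI.
- by rewrite Bk Bk' setIT.
- by apply: (@measurableI _ (g_sigma_algebraType
    (\bigcup_i g_sigma_algebra_preimage (Z i)))).
- by rewrite setIACA -bigcapI.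
Qed.

Lemma others_setT : others setT.
Proof.
exists (fun=> setT), setT; split=> //.
  exact: (@measurableT _ (g_sigma_algebraType
    (\bigcup_i g_sigma_algebra_preimage (Z i)))).
by rewrite setIT; apply/seteqP; split.
Qed.

Lemma others_measurable : others `<=` measurable.
Proof.
move=> _ [B [C [mB Bk ZC ->]]]; apply: measurableI.
  exact: generated_measurable (bigcap_generated mB).
exact: generated_measurable ZC.
Qed.

(** On the pi-system the product rule combines the independence of the weights
    among themselves with their independence from the family [Z]: adding the
    event [g k \in A] only changes the [k]-th factor. *)
Lemma independent_others (A : set R) H : measurable A -> <<s others >> H ->
  P (g k @^-1` A `&` H) = P (g k @^-1` A) * P H.
Proof.
move=> mA; apply: independent_generated.
- exact: others_setI.
- exact: others_setT.
- exact: others_measurable.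
- by rewrite -[_ @^-1` _]setTI; exact: measurable_funP.
move=> _ [B [C [mB Bk ZC ->]]].
pose B' l := if l == k then A else B l.
have mB' l : measurable (B' l) by rewrite /B'; case: ifP.
have -> : g k @^-1` A `&` (\bigcap_l (g l @^-1` B l) `&` C) =
    \bigcap_l (g l @^-1` B' l) `&` C.
  rewrite setIA; congr (_ `&` _); apply/seteqP; split=> t.
    by move=> [tA tB] l _; rewrite /B' /=; case: eqP => [->//|_]; exact: tB.
  move=> tB; split; first by have := tB k I; rewrite /= /B' eqxx.
  move=> l _; have := tB l I; rewrite /= /B'; case: eqP => // -> _.
  by rewrite Bk.
rewrite (gZ_indep (bigcap_generated mB') ZC) (gZ_indep (bigcap_generated mB) ZC).
rewrite !g_indep// muleA; congr (_ * _).
rewrite (bigD1 k)//= [in RHS](bigD1 k)//= Bk preimage_setT probability_setT mul1e.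
rewrite /B' eqxx; congr (_ * _); apply: eq_bigr => l lk.
by rewrite (negbTE lk).
Qed.

Let TO := g_sigma_algebraType others.

Lemma measurable_weight_others l : l != k -> measurable_fun setT (g l : TO -> R).
Proof.
move=> lk _ B mB; rewrite setTI; apply: sub_sigma_algebra.
exists (fun j => if j == l then B else setT), setT; split.
- by move=> j; case: ifP.
- by rewrite eq_sym (negbTE lk).
- exact: (@measurableT _ (g_sigma_algebraType
    (\bigcup_i g_sigma_algebra_preimage (Z i)))).
- rewrite setIT; apply/seteqP; split=> t.
    by move=> tB j _; rewrite /=; case: eqP => // ->.
  by move=> /(_ l I); rewrite /= eqxx.
Qed.

Lemma measurable_zero_others l : measurable_fun setT (Z l : TO -> R[i]).
Proof.
move=> _ B mB; rewrite setTI; apply: sub_sigma_algebra.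
exists (fun=> setT), (Z l @^-1` B); split=> //.
  by apply: sub_sigma_algebra; exists l => //; exists B => //; rewrite setTI.
rewrite [X in X `&` _](_ : _ = setT) ?setTI//.
by apply/seteqP; split.
Qed.

(** The value of [g k] that makes the real part of the normalised sum vanish. *)
Definition cancelling_value (y : R[i]) (t : T) : R :=
  (- \sum_(l < n | l != k)
     g l t * complex.Re (herglotz (Z l t) y / herglotz (Z k t) y))%R.

(** Measurability is meant for the smaller sigma-algebra generated by [others],
    which is what independence from [g k] requires. *)
Lemma measurable_cancelling_value y :
  measurable_fun setT (cancelling_value y : TO -> R).
Proof.
apply: measurable_funN.
under eq_fun do rewrite big_mkcond.
apply: measurable_sum => l; case: (boolP (l != k)) => [lk|_].
  2: exact: measurable_cst.
apply: measurable_funM; first exact: measurable_weight_others.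
have mh j : measurable_complex (fun t : TO => herglotz (Z j t) y).
  exact: measurable_herglotz (measurable_zero_others j).
by have [] := measurable_complexM (mh l) (measurable_complexV (mh k)).
Qed.

Lemma sub_others_measurable H : <<s others >> H -> measurable H.
Proof.
by apply: smallest_sub; [exact: sigma_algebra_measurable|exact: others_measurable].
Qed.

Lemma independent_cancelling_value y (A B : set R) :
  measurable A -> measurable B ->
  P (g k @^-1` A `&` cancelling_value y @^-1` B) =
  P (g k @^-1` A) * P (cancelling_value y @^-1` B).
Proof.
move=> mA mB; apply: independent_others => //.
have := measurable_cancelling_value y.
by move=> /(_ measurableT _ mB); rewrite setTI.
Qed.

Lemma measurable_fun_cancelling_value y :
  measurable_fun setT (cancelling_value y).
Proof.
move=> _ B mB; rewrite setTI; apply: sub_others_measurable.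
have := measurable_cancelling_value y.
by move=> /(_ measurableT _ mB); rewrite setTI.
Qed.

End others.
End independence.

(** * Anticoncentration of Gamma variables at the logarithmic scale *)

Section gamma_anticoncentration.
Context {R : realType}.
Variable a : R.
Hypothesis a_gt0 : 0 < a.

Lemma Gamma_ge0 : 0 <= Gamma a.
Proof.
rewrite fine_ge0// integral_ge0// => t _.
by rewrite lee_fin mulr_ge0 ?powR_ge0 ?expR_ge0.
Qed.

Lemma gamma_pdf_ge0 t : 0 <= gamma_pdf a t.
Proof.
rewrite /gamma_pdf patchE; case: ifPn => // _.
by rewrite !mulr_ge0 ?powR_ge0 ?expR_ge0// invr_ge0 Gamma_ge0.
Qed.

(** The maximum over [t] of [t * gamma_pdf a t], that is, of the density of the
    logarithm of a Gamma variable. It is attained at [t = a]. *)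
Definition gamma_peak : R := (Gamma a)^-1 * expR (a * ln a - a).

Lemma gamma_peak_ge0 : 0 <= gamma_peak.
Proof. by rewrite mulr_ge0 ?expR_ge0// invr_ge0 Gamma_ge0. Qed.

(** The inequality [ln x <= x - 1] at [x = t / a]. *)
Lemma gamma_pdf_le t : 0 < t -> gamma_pdf a t <= gamma_peak / t.
Proof.
move=> t0; rewrite /gamma_pdf patchE mem_set/=; last by rewrite in_itv/= t0.
rewrite /gamma_peak -!mulrA ler_wpM2l ?invr_ge0 ?Gamma_ge0//.
rewrite ler_pdivlMr// mulrAC -{2}[t](powRr1 (ltW t0)) -powRD; last first.
  by rewrite (gt_eqF t0) implybT.
rewrite subrK /powR (gt_eqF t0) -expRD ler_expR.
have at0 : 0 < t / a by rewrite divr_gt0.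
have ta1 : -1 < t / a - 1 by lra.
have := le_ln1Dx ta1; rewrite [1 + _]addrC subrK ln_div ?posrE// => h.
have : a * (ln t - ln a) <= a * (t / a - 1) by rewrite ler_wpM2l// ltW.
rewrite mulrBr [a * (t / a - 1)]mulrBr mulr1 mulrCA divff ?gt_eqF// mulr1.
lra.
Qed.

Lemma measurable_gamma_pdf : measurable_fun setT (gamma_pdf a).
Proof.
apply/(measurable_restrictT _ (measurable_itv _)); apply: measurable_funTS.
apply: measurable_funM.
  apply: measurable_funM; first exact: measurable_cst.
  exact: measurable_powR.
apply: (measurableT_comp (@measurable_expR R)).
exact: measurable_funN.
Qed.

Lemma gamma_prob_itv x y : 0 < x -> x <= y ->
  (gamma_prob a `]x, y[ <= (gamma_peak / x * (y - x))%:E)%E.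
Proof.
move=> x0 xy; rewrite /gamma_prob.
apply: (@le_trans _ _
  (\int[lebesgue_measure]_(t in `]x, y[) (cst (gamma_peak / x)%:E t))%E).
  apply: ge0_le_integral => //.
  - by move=> t _; rewrite lee_fin gamma_pdf_ge0.
  - by apply/measurable_EFinP; apply: measurable_funTS; exact: measurable_gamma_pdf.
  - move=> t; rewrite /= in_itv/= => /andP[xt ty].
    rewrite lee_fin (le_trans (gamma_pdf_le (lt_trans x0 xt)))//.
    by rewrite ler_wpM2l ?gamma_peak_ge0// lef_pV2 ?posrE ?(lt_trans x0 xt)// ltW.
rewrite integral_cst//= lebesgue_measure_itv/= lte_fin.
case: ifPn => [_|]; first by rewrite -EFinB -EFinM.
by move=> _; rewrite mule0 lee_fin mulr_ge0 ?subr_ge0// divr_ge0 ?gamma_peak_ge0// ltW.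
Qed.

Lemma gamma_prob_le0 : gamma_prob a `]-oo, 0]%classic = 0%E.
Proof.
rewrite /gamma_prob; apply: integral0_eq => t; rewrite /= in_itv/= => t0.
by rewrite /gamma_pdf patchE memNset//= in_itv/= andbT; apply/negP; rewrite -leNgt.
Qed.

Context d (T : measurableType d) (P : probability T R).
Variables (U : {RV P >-> R}) (X : T -> R).
Hypothesis mX : measurable_fun setT X.
Hypothesis law_U : forall A, measurable A -> distribution P U A = gamma_prob a A.
Hypothesis indep_UX : forall A B, measurable A -> measurable B ->
  P (U @^-1` A `&` X @^-1` B) = (P (U @^-1` A) * P (X @^-1` B))%E.

Lemma measurable_near_value delta :
  measurable [set t | `|U t - X t| < delta * U t].
Proof.
have mU : measurable_fun setT U by exact: measurable_funP.
have mlt : measurable_fun setT (fun t => `|U t - X t| < delta * U t).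
  apply: measurable_fun_ltr; last exact: measurable_funM.
  by apply: measurableT_comp => //; exact: measurable_funB.
by have := mlt measurableT [set true]; rewrite setTI => /(_ I).
Qed.

Lemma weight_positive_ae : {ae P, forall t, 0 < U t}.
Proof.
exists (U @^-1` `]-oo, 0]%classic); split.
- by rewrite -[X in measurable X]setTI; exact: measurable_funP.
- by have := law_U (measurable_itv `]-oo, 0]); rewrite gamma_prob_le0.
- by move=> t /=; rewrite in_itv/= => /negP; rewrite -leNgt.
Qed.

(** Given [X = x], the event confines [U] to an interval whose length is at most
    [4 * delta] times its left end, where the density is at most [gamma_peak]
    divided by that end. Sections of the joint law, which is a product by
    independence, make this rigorous. *)
Lemma near_value_prob delta : 0 < delta <= 1 / 2 ->
  (P [set t | `|U t - X t| < delta * U t]%R <= (4 * gamma_peak * delta)%:E)%E.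
Proof.
move=> /andP[d0 d2].
have mU : measurable_fun setT U by exact: measurable_funP.
have mXU : measurable_fun setT (fun t => (X t, U t)) by exact: measurable_fun_pair.
pose X' : {RV P >-> R} := mfun_Sub (mem_set mX).
pose XU : {RV P >-> (R * R)%type} := mfun_Sub (mem_set mXU).
pose E : set (R * R) := [set p | `|p.2 - p.1| < delta * p.2].
have mE : measurable E.
  have m1 : measurable_fun setT (fun p : R * R => p.1) by exact: measurable_fst.
  have m2 : measurable_fun setT (fun p : R * R => p.2) by exact: measurable_snd.
  have mlt : measurable_fun setT (fun p : R * R => `|p.2 - p.1| < delta * p.2).
    apply: measurable_fun_ltr; last exact: measurable_funM.
    by apply: measurableT_comp => //; exact: measurable_funB.
  by have := mlt measurableT [set true]; rewrite setTI => /(_ I).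
have -> : P [set t | `|U t - X t| < delta * U t] = distribution P XU E by [].
rewrite -(@product_measure_unique _ _ _ _ R (distribution P X') (distribution P U)
  (distribution P XU))//; last first.
  move=> A B mA mB; rewrite muleC.
  have := indep_UX mB mA; rewrite setIC.
  by rewrite /distribution /pushforward /= => <-.
rewrite /product_measure1.
have sec x : (distribution P U (xsection E x) <= (4 * gamma_peak * delta)%:E)%E.
  have K0 := gamma_peak_ge0.
  have mS : measurable (xsection E x) by exact: measurable_xsection.
  have [x0|x0] := leP x 0.
    have -> : xsection E x = set0.
      apply/seteqP; split=> // u; rewrite /xsection/= inE /E/= ltr_norml => /andP[? ?].
      nra.
    by rewrite measure0 lee_fin mulr_ge0 ?(ltW d0)// mulr_ge0.
  have d1 : 0 < 1 + delta by lra.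
  have d1' : 0 < 1 - delta by lra.
  apply: (@le_trans _ _ (distribution P U `]x / (1 + delta), x / (1 - delta)[%classic)).
    apply: le_measure; rewrite ?inE//.
    move=> u; rewrite /xsection/= inE /E/= ltr_norml in_itv/= => /andP[h1 h2].
    by rewrite ltr_pdivrMr// ltr_pdivlMr//; apply/andP; split; lra.
  rewrite law_U// (le_trans (gamma_prob_itv _ _))//.
  - by rewrite divr_gt0.
  - by rewrite ler_pM2l// lef_pV2 ?posrE//; lra.
  rewrite lee_fin.
  have -> : gamma_peak / (x / (1 + delta)) * (x / (1 - delta) - x / (1 + delta)) =
      gamma_peak * (2 * delta / (1 - delta)).
    by field; rewrite !gt_eqF.
  have -> : 4 * gamma_peak * delta = gamma_peak * (4 * delta) by ring.
  by rewrite ler_wpM2l// ler_pdivrMr//; nra.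
apply: (@le_trans _ _
  (\int[distribution P X']_x (cst (4 * gamma_peak * delta)%:E x))%E).
  apply: ge0_le_integral => //=.
  exact: measurable_fun_xsection.
rewrite integral_cst//= /distribution /pushforward preimage_setT.
by rewrite probability_setT mule1.
Qed.

End gamma_anticoncentration.

(** * Almost sure absence of cancellation *)

Section almost_sure_events.
Context d (T : measurableType d) {R : realType} (P : probability T R).

Lemma measure_bigsetU_le (I : Type) (s : seq I) (F : I -> set T) (b : R) :
  (forall i, measurable (F i)) -> (forall i, P (F i) <= b%:E)%E ->
  (P (\big[setU/set0]_(i <- s) F i) <= ((size s)%:R * b)%:E)%E.
Proof.
move=> mF Fb; elim: s => [|i s IH]; first by rewrite big_nil measure0 mul0r.
rewrite big_cons (le_trans (measureU2 _ _ _))//.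
  by apply: bigsetU_measurable.
have -> : (size (i :: s))%:R * b = b + (size s)%:R * b.
  by rewrite /= -[(size s).+1]add1n natrD mulrDl mul1r.
rewrite EFinD; exact: leeD (Fb i) IH.
Qed.

(** The bound [b / n ^+ 2] is at most [6 * b] times the difference of the
    inverses of [n + 1] and [n + 2], whose partial sums telescope. *)
Lemma borel_cantelli_inverse_square (F : nat -> set T) (b : R) :
  (forall n, measurable (F n)) -> 0 <= b -> F 0%N = set0 ->
  (forall n, (0 < n)%N -> P (F n) <= (b / n%:R ^+ 2)%:E)%E ->
  {ae P, forall t, \forall n \near \oo, ~ F n t}.
Proof.
move=> mF b0 F0 Fb.
have FE n : (P (F n) <= (6 * b * (n.+1%:R^-1 - n.+2%:R^-1))%:E)%E.
  case: n => [|n].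
    rewrite F0 measure0 lee_fin !mulr_ge0// subr_ge0 lef_pV2 ?posrE//.
    by rewrite ler_nat.
  rewrite (le_trans (Fb n.+1 _))// lee_fin.
  have n1 : 1 <= n.+1%:R :> R by rewrite ler1n.
  have -> : n.+2%:R = n.+1%:R + 1 :> R by rewrite -natr1.
  have -> : n.+3%:R = n.+1%:R + 2 :> R by rewrite -natrD addn2.
  move: (n.+1%:R : R) n1 => x x1.
  have -> : 6 * b * ((x + 1)^-1 - (x + 2)^-1) = b * (6 / ((x + 1) * (x + 2))).
    by field; rewrite !gt_eqF//; lra.
  rewrite ler_wpM2l// -div1r ler_pdivrMr ?exprn_gt0//; last lra.
  rewrite mulrAC ler_pdivlMr; last by rewrite mulr_gt0//; lra.
  nra.
have sum_le N : (\sum_(0 <= n < N) P (F n) <= (6 * b * (1 - N.+1%:R^-1))%:E)%E.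
  elim: N => [|N IH]; first by rewrite big_geq// invr1 subrr mulr0.
  rewrite big_nat_recr//= (le_trans (leeD IH (FE N)))//.
  by rewrite -EFinD lee_fin -mulrDr addrA subrK.
have lim0 : P (lim_sup_set F) = 0%E.
  apply: lim_sup_set_cvg0 => //.
  apply: (@le_lt_trans _ _ (6 * b)%:E); last exact: ltry.
  apply: lime_le.
    by apply: is_cvg_nneseries => n _ _; exact: measure_ge0.
  near=> N; rewrite (le_trans (sum_le N))// lee_fin.
  by rewrite ler_piMr ?mulr_ge0// lerBlDr lerDl invr_ge0.
exists (lim_sup_set F); split=> //.
  by apply: bigcapT_measurable => n; apply: bigcup_measurable.
move=> t nF N _; apply: contrapT => nE; apply: nF.
by exists N => // n Nn Fn; apply: nE; exists n.
Unshelve. all: by end_near. Qed.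

Variables (a : R).
Hypothesis a_gt0 : 0 < a.

Section one_size.
Variables (n : nat) (Z : 'I_n -> {RV P >-> R[i]}) (g : 'I_n -> {RV P >-> R}).
Hypothesis law_g : forall k A, measurable A -> distribution P (g k) A = gamma_prob a A.
Hypothesis g_indep : mutually_independent g.
Hypothesis gZ_indep : independent_families g Z.

Definition cancellation (delta : R) (s : seq R[i]) : set T :=
  \big[setU/set0]_(y <- s) \big[setU/set0]_(k < n)
    [set t | `|g k t - cancelling_value g Z k y t| < delta * g k t].

Lemma measurable_cancellation delta s : measurable (cancellation delta s).
Proof.
apply: bigsetU_measurable => y _; apply: bigsetU_measurable => k _.
apply: measurable_near_value; exact: measurable_fun_cancelling_value.
Qed.

(** Union bound over the points and over the index [k]. *)
Lemma cancellation_prob delta s : 0 < delta <= 1 / 2 ->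
  (P (cancellation delta s) <=
    ((size s)%:R * (n%:R * (4 * gamma_peak a * delta)))%:E)%E.
Proof.
move=> d01; apply: measure_bigsetU_le => y.
  apply: bigsetU_measurable => k _.
  by apply: measurable_near_value; exact: measurable_fun_cancelling_value.
have := @measure_bigsetU_le 'I_n (index_enum 'I_n) (fun k =>
  [set t | `|g k t - cancelling_value g Z k y t| < delta * g k t])
  (4 * gamma_peak a * delta).
have -> : size (index_enum 'I_n) = n.
  by rewrite -[RHS](card_ord n) cardT enumT.
apply=> k.
  by apply: measurable_near_value; exact: measurable_fun_cancelling_value.
apply: near_value_prob => //.
- exact: measurable_fun_cancelling_value.
- exact: law_g.
- by move=> A B mA mB; exact: independent_cancelling_value.
Qed.

Lemma no_cancellation_outside delta s t : ~ cancellation delta s t ->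
  forall y, y \in s -> no_cancellation (fun k => Z k t) (fun k => g k t) delta y.
Proof.
move=> nc y ys k; rewrite leNgt; apply/negP => lt_k; apply: nc.
rewrite /cancellation -bigcup_seq; exists y => //=.
rewrite -bigcup_seq; exists k; first by rewrite /= mem_index_enum.
rewrite /=.
by rewrite /cancelling_value opprK.
Qed.

End one_size.

(** There are [(3 n + 1) n] points and [n] indices, so the exponent [5] leaves a
    probability of order [n ^- 2]. *)
Lemma no_cancellation_ae (Z : forall n, 'I_n -> {RV P >-> R[i]})
    (g : forall n, 'I_n -> {RV P >-> R}) (c : R[i]) (r : R) :
  (forall n k A, measurable A -> distribution P (g n k) A = gamma_prob a A) ->
  (forall n, mutually_independent (g n)) ->
  (forall n, independent_families (g n) (Z n)) ->
  {ae P, forall t, \forall n \near \oo, forall y, y \in grid_points n c r ->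
    no_cancellation (fun k => Z n k t) (fun k => g n k t) (n%:R ^- 5) y}.
Proof.
move=> law_g g_indep gZ_indep; have K0 : 0 <= gamma_peak a by exact: gamma_peak_ge0.
have : {ae P, forall t, \forall n \near \oo,
    ~ cancellation (Z n) (g n) (n%:R ^- 5) (grid_points n c r) t}.
  apply: (@borel_cantelli_inverse_square _ (16 * gamma_peak a + 1)).
  - by move=> n; exact: measurable_cancellation.
  - by rewrite addr_ge0// mulr_ge0.
  - by rewrite /cancellation; under eq_bigr do rewrite big_ord0; rewrite big1.
  (* for [n = 1] the exponent gives [delta = 1], and the bound is trivial *)
  move=> [//|[_|n _]].
    rewrite !expr1n divr1; apply: (@le_trans _ _ 1%:E).
      by apply: probability_le1; exact: measurable_cancellation.
    by rewrite lee_fin lerDr mulr_ge0.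
  set m := n.+2; have m2 : 2 <= m%:R :> R by rewrite ler_nat.
  have m0 : 0 < m%:R :> R by lra.
  have d01 : 0 < (m%:R ^- 5 : R) <= 1 / 2.
    rewrite invr_gt0 exprn_gt0//= div1r lef_pV2 ?posrE ?exprn_gt0//.
    by rewrite (le_trans m2)// ler_eXnr//; lra.
  rewrite (le_trans (cancellation_prob (law_g m) (g_indep m) (gZ_indep m) _ d01))//.
  rewrite lee_fin size_grid_points// natrM.
  have -> : (3 * m).+1%:R = 3 * m%:R + 1 :> R by rewrite -natr1 natrM.
  move: (m%:R : R) m2 m0 => x x2 x0 {d01}.
  have -> : (3 * x + 1) * x * (x * (4 * gamma_peak a * x ^- 5)) =
     (3 * x + 1) / x * 4 * gamma_peak a / x ^+ 2.
    by field; rewrite gt_eqF.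
  rewrite ler_pM2r ?invr_gt0 ?exprn_gt0//.
  have : (3 * x + 1) / x <= 4 by rewrite ler_pdivrMr//; lra.
  move=> h; have := ler_wpM2r K0 h; lra.
apply: filterS => t; apply: filterS => n /no_cancellation_outside; exact.
Qed.

End almost_sure_events.

(** * Weak convergence of the zeros *)

Section deterministic_theorem.
Context {R : realType}.
Local Notation C := R[i].

Lemma ln_sublinear (K e : R) : 0 < e ->
  \forall n \near \oo, K + 20 * ln n%:R <= e * n%:R.
Proof.
move=> e0; near=> n.
have n0 : 0 < n%:R :> R by rewrite ltr0n; near: n; exact: nbhs_infty_gt.
have e2 : 0 < e / 2 by rewrite divr_gt0.
have h1 : `|K| / (e / 2) <= n%:R.
  near: n; exact: nbhs_infty_ger.
have h2 : (40 / (e / 2)) ^+ 2 <= n%:R.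
  near: n; exact: nbhs_infty_ger.
have s0 : 0 < Num.sqrt n%:R :> R by rewrite sqrtr_gt0.
have sn : Num.sqrt n%:R ^+ 2 = n%:R :> R by rewrite sqr_sqrtr// ltW.
have h3 : 40 / (e / 2) <= Num.sqrt n%:R.
  rewrite -(ler_pXn2r (n := 2)) ?nnegrE ?sqrtr_ge0 ?sn// divr_ge0//.
  exact: ltW.
have lns : ln n%:R <= 2 * Num.sqrt n%:R :> R.
  rewrite -sn lnXn// mulr_natl ler_wMn2r//.
  have s1 : -1 < Num.sqrt n%:R - 1 :> R by lra.
  by have := le_ln1Dx s1; rewrite [1 + _]addrC subrK sn; lra.
rewrite ler_pdivrMr// in h1; rewrite ler_pdivrMr// in h3.
have := ler_norm K.
have h4 : 40 * Num.sqrt n%:R <= n%:R * (e / 2).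
  have -> : n%:R * (e / 2) = Num.sqrt n%:R * (e / 2) * Num.sqrt n%:R.
    by rewrite mulrAC -expr2 sn.
  by rewrite ler_wpM2r// ltW.
lra.
Unshelve. all: by end_near. Qed.

(** The averages of a tent over the zeros of the polynomials and over those of
    their circular derivatives differ by [O(ln n / n)], so the weak limit of
    the former is inherited by the latter. The limit has mass one because the
    constant function [1] is a test function. *)
Lemma zeros_weakly_cvg (Z : forall n, 'I_n -> C) (g : forall n, 'I_n -> R)
    (mu : {measure set C -> \bar R}) :
  (forall n k, 0 < g n k) ->
  (forall m i j (r : R), r \in [:: 2 / m.+1%:R; 4 / m.+1%:R] ->
     \forall n \near \oo, forall y, y \in grid_points n (center m i j) r ->
     no_cancellation (Z n) (g n) (n%:R ^- 5) y) ->
  weakly_cvg (fun n => empirical_measure [seq Z n k | k : 'I_n]) mu ->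
  weakly_cvg (fun n => empirical_measure (zeros (circular_derivative (Z n) (g n)))) mu.
Proof.
move=> g0 nc cvgZ.
pose zs n := [seq Z n k | k : 'I_n].
pose ws n := zeros (circular_derivative (Z n) (g n)).
have szs n : size (zs n) = n by rewrite size_image card_ord.
have sws n : (0 < n)%N -> size (ws n) = n.
  by move=> n0; exact: size_zeros_circular_derivative.
have cvgJ f : bounded_continuous f ->
    ((mean zs n f)%:E @[n --> \oo] --> \int[mu]_z (f z)%:E)%E.
  move=> [fc [M fM]]; have fb : bounded_fun f.
    exists M; split; first exact: num_real.
    by move=> K MK z _; exact: le_trans (fM z) (ltW MK).
  have := cvgZ f fc fb.
  under eq_fun do
    rewrite (integral_empirical_measure _ (complex_continuous_measurable fc)).
  by [].
have mu1 : mu setT = 1%E.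
  have := cvgJ _ (bounded_continuous_cst 1).
  rewrite integral_cst// mul1e => /cvg_lim <-//.
  apply: cvg_lim => //; apply: cvg_near_cst.
  near=> n; rewrite mean_cst// szs; near: n; exact: nbhs_infty_gt.
apply: weakly_cvg_empirical_measure => //.
  near=> n; have n0 : (0 < n)%N by near: n; exact: nbhs_infty_gt.
  by rewrite sws.
move=> m i j.
have r0 : 0 < 2 / m.+1%:R :> R by rewrite divr_gt0.
have rs : 2 / m.+1%:R <= 4 / m.+1%:R :> R by rewrite ler_pM2r ?invr_gt0//; lra.
have s0 := lt_le_trans r0 rs.
have tb : bounded_continuous (@lattice_tent R m i j).
  exact: bounded_continuous_tent.
have := cvgJ _ tb; rewrite (integral_bounded_continuous mu1 tb).
move=> /fine_cvgP[_ /= zsJ].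
have [K HK] := tent_sum_circular_derivative (center m i j) r0 s0.
have diff0 : (mean ws n (lattice_tent m i j) - mean zs n (lattice_tent m i j))
    @[n --> \oo] --> 0.
  apply/cvgrPdist_le => e e0; near=> n; rewrite sub0r normrN.
  have n0 : (0 < n)%N by near: n; exact: nbhs_infty_gt.
  have np : 0 < n%:R :> R by rewrite ltr0n.
  rewrite /mean szs sws// -mulrBr normrM gtr0_norm ?invr_gt0//.
  rewrite ler_pdivrMl// mulrC; apply: le_trans (HK n (Z n) (g n) n0 (g0 n) _ _) _.
  - by near: n; apply: nc; rewrite mem_head.
  - by near: n; apply: nc; rewrite !inE eqxx orbT.
  - by near: n; exact: ln_sublinear.
have wsE : mean ws ^~ (lattice_tent m i j) = (fun n =>
    (mean ws n (lattice_tent m i j) - mean zs n (lattice_tent m i j)) +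
    mean zs n (lattice_tent m i j)).
  by apply/funext => n; rewrite subrK.
by rewrite -[X in _ --> X]add0r wsE; exact: cvgD diff0 zsJ.
Unshelve. all: by end_near. Qed.

End deterministic_theorem.

Theorem theorem4 (R : realType) (d : measure_display) (T : measurableType d)
  (P : probability T R) (beta : R)
  (Z : forall n : nat, 'I_n -> {RV P >-> R[i]})
  (gamma : forall n : nat, 'I_n -> {RV P >-> R})
  (mu : {measure set R[i] -> \bar R}) :
  0 < beta ->
  (forall n k A, measurable A ->
    distribution P (gamma n k) A = gamma_prob (beta / 2) A) ->
  (forall n, mutually_independent (gamma n)) ->
  (forall n, independent_families (gamma n) (Z n)) ->
  {ae P, forall w,
    weakly_cvg (fun n => empirical_measure [seq Z n k w | k : 'I_n]) mu} ->
  {ae P, forall w,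
    weakly_cvg (fun n => empirical_measure
      (zeros (circular_derivative (fun k => Z n k w) (fun k => gamma n k w))))
      mu}.
Proof.
move=> beta0 law_gamma gamma_indep gammaZ_indep cvgZ.
have a0 : 0 < beta / 2 by rewrite divr_gt0.
have gamma_pos : {ae P, forall w, forall n k, 0 < gamma n k w}.
  have : {ae P, forall w, forall n j (jn : (j < n)%N), 0 < gamma n (Ordinal jn) w}.
    apply/ae_foralln => n; apply/ae_foralln => j.
    have [jn|nj] := pselect (j < n)%N; last by apply: aeW => w jn; case: nj.
    have := weight_positive_ae (law_gamma n (Ordinal jn)).
    by apply: filterS => w gw jn'; rewrite (bool_irrelevance jn' jn).
  by apply: filterS => w gw n [j jn]; exact: gw.
have nc r : {ae P, forall w, forall m i j, \forall n \near \oo,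
    forall y, y \in grid_points n (center m i j) (r m) ->
    no_cancellation (fun k => Z n k w) (fun k => gamma n k w) (n%:R ^- 5) y}.
  apply/ae_foralln => m; apply/ae_foralln => i; apply/ae_foralln => j.
  exact: no_cancellation_ae law_gamma gamma_indep gammaZ_indep.
have nc2 := nc (fun m => 2 / m.+1%:R).
have nc4 := nc (fun m => 4 / m.+1%:R).
apply: filterS2 (filterI gamma_pos cvgZ) (filterI nc2 nc4) => w [gw Zw] [nc2w nc4w].
apply: zeros_weakly_cvg => // m i j r; rewrite !inE => /orP[]/eqP ->.
  exact: nc2w.
exact: nc4w.
Qed.
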